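(* Consider an irrotational deep-water Stokes wave and let $p\in(0,+\infty)$. For the fluid particle located initially (at time $0$) at $(x_0,y_0)$ with $y_0=\xi_p(x_0)$, set $$\mathcal{E}(p,x_0)=\frac12\int_0^{\mathcal{T}(p)}\big[(x'(t;x_0))^2+(y'(t;x_0))^2\big]\,dt,\qquad \mathbb{E}(p,x_0)=\frac12\int_0^{\mathcal{T}(p)}\big[(x'(t;x_0)-c)^2+(y'(t;x_0))^2\big]\,dt.$$ Then $\mathcal{E}(p,x_0)$ depends solely on the streamline $p$ and is independent of the initial location $x_0$; as a function of $p\in(0,+\infty)$ it is convex and non-increasing, and $\log\mathcal{E}(p,x_0)$ is a convex function of $p$. Moreover, $\mathbb{E}(p,x_0)$ is equal to the constant $c\lambda/2$.
   Context: Setting (irrotational deep-water Stokes wave in the moving frame). Let $c>0$ (wave speed), $\lambda>0$ (wavelength), $g>0$ and $P_{atm}$ be constants. In the frame moving with the wave (horizontal coordinate $x$ stands for $x-ct$), the free surface is $y=\eta(x)$, the fluid domain is $D=\{(x,y)\in\mathbb{R}^2:-\infty<y<\eta(x)\}$, $(u(x,y),v(x,y))$ is the velocity field and $P(x,y)$ the pressure. They satisfy - $(u-c)u_x+vu_y=-P_x$, $(u-c)v_x+vv_y=-P_y-g$, $u_x+v_y=0$, $u_y-v_x=0$ in $D$; - $v=(u-c)\eta_x$ and $P=P_{atm}$ on $y=\eta(x)$; - $(u,v)\to(0,0)$ as $y\to-\infty$, uniformly in $x$; - $u(x,y)<c$ for all $-\infty<y\le\eta(x)$. The functions $\eta,u,v,P$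 are $\lambda$-periodic in $x$; $\eta,u,P$ are symmetric (even) about the crest line $x=0$; $\eta$ is strictly increasing on $[-\lambda/2,0]$ and strictly decreasing on $[0,\lambda/2]$ (a single crest and trough per period). The velocity field $(u,v)$ is bounded and continuously differentiable throughout the fluid domain. Streamlines. The stream function $\psi$ is given by $\psi_y=u-c$, $\psi_x=-v$ in $D$, $\psi=0$ on $y=\eta(x)$; it takes all values in $(0,+\infty)$ on each vertical line in $D$. For $p>0$ the streamline $p$ is the curve $y=\xi_p(x)$ determined by $\psi(x,\xi_p(x))=p$. Particle paths. In the fixed frame, particle paths solve $x'(t)=u(x(t)-ct,y(t))$, $y'(t)=v(x(t)-ct,y(t))$. The path $(x(t;x_0),y(t;x_0))$ is the solution with $(x(0),y(0))=(x_0,y_0)$, $y_0=\xi_p(x_0)$. The streamline time-period $\mathcal{T}(p)$ is the unique $\mathcal{T}>0$ with $x(\mathcal{T};x_0)-c\mathcal{T}=x_0-\lambda$; it depends only on $p$, not on $x_0$. $\mathcal{E}$ is the total kinetic energy of the particle over a streamline time-period, and $\mathbb{E}$ its counterpart in the moving frame. *)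

(* Defs.v *)
From Stdlib Require Export Reals.
From Coquelicot Require Export Coquelicot.
Open Scope R_scope.

Definition dx (f : R -> R -> R) (x y : R) : R := Derive (fun s => f s y) x.
Definition dy (f : R -> R -> R) (x y : R) : R := Derive (fun s => f x s) y.

Definition C1_in (D : R -> R -> Prop) (f : R -> R -> R) : Prop :=
  forall x y, D x y ->
    ex_derive (fun s => f s y) x /\ ex_derive (fun s => f x s) y /\
    continuity_2d_pt (dx f) x y /\ continuity_2d_pt (dy f) x y.

Definition fluid (eta : R -> R) (x y : R) : Prop := y < eta x.

Definition closed_fluid (eta : R -> R) (x y : R) : Prop := y <= eta x.

(* Fields are total functions on the plane; only their values on the closed
   fluid domain are meaningful, so continuity is relative to that domain. *)
Definition continuous_up_to_surface (eta : R -> R) (f : R -> R -> R) : Prop :=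
  continuous_on (fun z : R * R => closed_fluid eta (fst z) (snd z))
                (fun z : R * R => f (fst z) (snd z)).

(* Deep-water irrotational Stokes wave in the moving frame: the horizontal
   coordinate [x] stands for [x - c t]. *)
Record stokes_wave (c lam g Patm : R) (eta : R -> R) (u v P : R -> R -> R)
  : Prop := {
  sw_c : 0 < c;
  sw_lam : 0 < lam;
  sw_g : 0 < g;

  sw_eta_diff : forall x, ex_derive eta x;
  sw_u_C1 : C1_in (fluid eta) u;
  sw_v_C1 : C1_in (fluid eta) v;
  sw_P_C1 : C1_in (fluid eta) P;
  sw_u_cont : continuous_up_to_surface eta u;
  sw_v_cont : continuous_up_to_surface eta v;
  sw_P_cont : continuous_up_to_surface eta P;
  sw_bounded : exists M, forall x y, fluid eta x y ->
    Rabs (u x y) <= M /\ Rabs (v x y) <= M;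

  sw_euler_x : forall x y, fluid eta x y ->
    (u x y - c) * dx u x y + v x y * dy u x y = - dx P x y;
  sw_euler_y : forall x y, fluid eta x y ->
    (u x y - c) * dx v x y + v x y * dy v x y = - dy P x y - g;
  sw_incompressible : forall x y, fluid eta x y -> dx u x y + dy v x y = 0;
  sw_irrotational : forall x y, fluid eta x y -> dy u x y - dx v x y = 0;

  sw_kinematic : forall x, v x (eta x) = (u x (eta x) - c) * Derive eta x;
  sw_dynamic : forall x, P x (eta x) = Patm;
  sw_deep : forall eps, 0 < eps -> exists Y, forall x y,
    fluid eta x y -> y < Y -> Rabs (u x y) < eps /\ Rabs (v x y) < eps;
  sw_no_stagnation : forall x y, closed_fluid eta x y -> u x y < c;

  sw_eta_per : forall x, eta (x + lam) = eta x;
  sw_u_per : forall x y, closed_fluid eta x y -> u (x + lam) y = u x y;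
  sw_v_per : forall x y, closed_fluid eta x y -> v (x + lam) y = v x y;
  sw_P_per : forall x y, closed_fluid eta x y -> P (x + lam) y = P x y;
  sw_eta_even : forall x, eta (- x) = eta x;
  sw_u_even : forall x y, closed_fluid eta x y -> u (- x) y = u x y;
  sw_P_even : forall x y, closed_fluid eta x y -> P (- x) y = P x y;
  sw_eta_incr : forall a b, - (lam / 2) <= a -> a < b -> b <= 0 ->
    eta a < eta b;
  sw_eta_decr : forall a b, 0 <= a -> a < b -> b <= lam / 2 ->
    eta b < eta a
}.

Record stream_function (c : R) (eta : R -> R) (u v psi : R -> R -> R)
  : Prop := {
  sf_y : forall x y, fluid eta x y ->
    is_derive (fun s => psi x s) y (u x y - c);
  sf_x : forall x y, fluid eta x y ->
    is_derive (fun s => psi s y) x (- v x y);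
  sf_cont : continuous_up_to_surface eta psi;
  sf_surface : forall x, psi x (eta x) = 0
}.

(* [xi p] is the streamline [p]; since [psi] is strictly decreasing in [y],
   this determines [xi p x] for every [p > 0]. *)
Definition streamlines (eta : R -> R) (psi xi : R -> R -> R) : Prop :=
  forall p x, 0 < p -> fluid eta x (xi p x) /\ psi x (xi p x) = p.

(* Path in the fixed frame of the particle located at [(x0, y0)] at time 0. *)
Record particle_path (c : R) (eta : R -> R) (u v : R -> R -> R) (x0 y0 : R)
    (x y : R -> R) : Prop := {
  pp_x0 : x 0 = x0;
  pp_y0 : y 0 = y0;
  pp_fluid : forall t, closed_fluid eta (x t - c * t) (y t);
  pp_x : forall t, is_derive x t (u (x t - c * t) (y t));
  pp_y : forall t, is_derive y t (v (x t - c * t) (y t))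
}.

(* As [u < c], [x t - c * t] is strictly decreasing in [t], so that at most
   one [T] satisfies this. *)
Definition time_period (c lam x0 : R) (x : R -> R) (T : R) : Prop :=
  0 < T /\ x T - c * T = x0 - lam.

Definition kinetic_energy (x y : R -> R) (T : R) : R :=
  / 2 * RInt (fun t => (Derive x t) ^ 2 + (Derive y t) ^ 2) 0 T.

Definition moving_kinetic_energy (c : R) (x y : R -> R) (T : R) : R :=
  / 2 * RInt (fun t => (Derive x t - c) ^ 2 + (Derive y t) ^ 2) 0 T.

Definition convex_pos (f : R -> R) : Prop :=
  forall a b s, 0 < a -> 0 < b -> 0 <= s <= 1 ->
    f (s * a + (1 - s) * b) <= s * f a + (1 - s) * f b.

Definition nonincreasing_pos (f : R -> R) : Prop :=
  forall a b, 0 < a -> a <= b -> f b <= f a.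

(* Main.v *)
Require Import Defs.
From Stdlib Require Import Lra Lia ZArith IndefiniteDescription.

(** Write [f = u - c - i v], which is holomorphic in [z = x + i y] and does not
    vanish, and let [phi] be the velocity potential of the moving-frame flow, so
    that [phi + i psi] is a primitive of [f].  The map
    [(x, y) |-> (q, p) = (phi, psi)] straightens the fluid domain into a half
    plane: the streamlines become the lines [p = const], and one wavelength
    becomes the [q]-period [L = c lam]; the mean horizontal velocity at infinite
    depth being zero, the potential drops by exactly [c lam] per wavelength
    ([potential_per]).

    A particle moves with velocity [(u - c, v)], so [q] increases along its path
    at the rate [dq/dt = (u - c)^2 + v^2].  Integrating this rate over the
    streamline period gives the moving-frame energy [c lam / 2]
    ([moving_kinetic_energy_eq]).  Using [q] as integration variable turns the
    fixed-frame energy into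
    [E(p) = 1/2 int_0^L (u^2 + v^2) / ((u - c)^2 + v^2) dq
          = 1/2 int_0^L |F(q + i p)|^2 dq],  where [F = 1 + c / f = (u - i v) / f]
    ([kinetic_energy_eq]); the right-hand side no longer sees the starting point.

    [F] is a periodic holomorphic function of [q + i p], and log-convexity of [E]
    is a three-lines theorem for its [L^2] means.  The Cauchy-Riemann equations
    make the [s]-derivative of
    [int_0^L F(q, m + s) conj (F(q, m - s)) dq]
    the integral of an exact [q]-derivative, so this pairing does not depend on
    [s] ([line_pairing_reflection]).  Comparing [s = 0] with general [s],
    Cauchy-Schwarz gives [E(m)^2 <= E(m + s) E(m - s)]
    ([line_mean_log_midpoint]), and for a continuous function such midpoint
    inequalities are full convexity ([log_midpoint_convex]).  Only first
    derivatives of [F] enter, hence only first derivatives of the velocity.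

    The velocity decays with depth, so [E] stays bounded as [p] grows, and a
    convex function bounded at infinity is non-increasing
    ([convex_pos_bounded_nonincreasing]).  If [E] vanished at one [p], the
    midpoint inequality would make it vanish identically, the fluid would be at
    rest and the surface flat ([surface_not_flat]); hence [E > 0].

    The inverse of [(phi, psi)] is obtained from two one-variable inversions:
    [psi] is decreasing in [y], which gives the streamlines, and [phi] is
    decreasing in [x] along each of them.  Monotonicity makes these inverses
    jointly continuous ([decreasing_inverse_continuity]), and a continuous local
    inverse of a differentiable map with invertible Jacobian is differentiable
    ([curve_derivative]). *)

(** * Calculus in one and two variables *)

Lemma continuous_R_eps (f : R -> R) (t : R) :
  (forall eps, 0 < eps -> locally t (fun s => Rabs (f s - f t) < eps)) <->
  continuous f t.
Proof.
  split; intros H.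
  - apply filterlim_locally; intros eps. exact (H eps (cond_pos eps)).
  - intros eps He. exact (proj1 (filterlim_locally _ _) H (mkposreal eps He)).
Qed.

Lemma continuity_2d_pt_comp (f g h : R -> R -> R) (x y : R) :
  continuity_2d_pt g x y -> continuity_2d_pt h x y ->
  continuity_2d_pt f (g x y) (h x y) ->
  continuity_2d_pt (fun s t => f (g s t) (h s t)) x y.
Proof.
  intros Hg Hh Hf eps.
  destruct (Hf eps) as [d Hd].
  generalize (locally_2d_and _ _ _ _ (Hg d) (Hh d)).
  apply locally_2d_impl, locally_2d_forall.
  intros s t [H1 H2]; apply Hd; assumption.
Qed.

Lemma continuous_comp_2d (f : R -> R -> R) (g h : R -> R) (t : R) :
  continuity_2d_pt f (g t) (h t) -> continuous g t -> continuous h t ->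
  continuous (fun s => f (g s) (h s)) t.
Proof.
  intros Hf Hg Hh.
  apply (continuous_comp_2 g h f); try assumption.
  now apply continuity_2d_pt_filterlim in Hf.
Qed.

Lemma continuity_2d_pt_slice_l (f : R -> R -> R) (x y : R) :
  continuity_2d_pt f x y -> continuous (fun s => f s y) x.
Proof.
  intros H; apply (continuous_comp_2d f (fun s => s) (fun _ => y)); trivial.
  apply continuous_id. apply continuous_const.
Qed.

Lemma continuity_2d_pt_slice_r (f : R -> R -> R) (x y : R) :
  continuity_2d_pt f x y -> continuous (fun s => f x s) y.
Proof.
  intros H; apply (continuous_comp_2d f (fun _ => x) (fun s => s)); trivial.
  apply continuous_const. apply continuous_id.
Qed.

Lemma is_derive_continuous (f : R -> R) (t l : R) :
  is_derive f t l -> continuous f t.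
Proof. intros H; apply @ex_derive_continuous; now exists l. Qed.

Lemma continuous_Rplus (f g : R -> R) (t : R) :
  continuous f t -> continuous g t -> continuous (fun s => f s + g s) t.
Proof. exact (continuous_plus f g t). Qed.

Lemma continuous_Rminus (f g : R -> R) (t : R) :
  continuous f t -> continuous g t -> continuous (fun s => f s - g s) t.
Proof. exact (continuous_minus f g t). Qed.

Lemma continuous_Rmult (f g : R -> R) (t : R) :
  continuous f t -> continuous g t -> continuous (fun s => f s * g s) t.
Proof. exact (continuous_mult f g t). Qed.

Lemma continuous_Rinv (f : R -> R) (t : R) :
  continuous f t -> f t <> 0 -> continuous (fun s => / f s) t.
Proof.
  intros Hf H0; apply (continuous_comp f Rinv); trivial.
  apply @ex_derive_continuous; auto_derive; trivial.
Qed.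

(** Slopes that are continuous at the base point replace the little-o remainder,
    so that [curve_derivative] below reduces to Cramer's rule. *)
Lemma caratheodory_1d (f : R -> R) (t0 l : R) :
  is_derive f t0 l <->
  exists a : R -> R, continuous a t0 /\ a t0 = l /\
    locally t0 (fun t => f t - f t0 = a t * (t - t0)).
Proof.
  rewrite is_derive_Reals; split.
  - intros H.
    exists (fun t => if Req_EM_T t t0 then l else (f t - f t0) / (t - t0)).
    split; [|split].
    + apply continuous_R_eps; intros eps He.
      destruct (H eps He) as [d Hd].
      exists d; intros t Ht; change (Rabs (t - t0) < d) in Ht.
      destruct (Req_EM_T t0 t0) as [_|n]; [|now elim n].
      destruct (Req_EM_T t t0) as [_|n].
      * rewrite Rminus_diag, Rabs_R0; assumption.
      * specialize (Hd (t - t0)).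
        rewrite Rplus_minus in Hd.
        apply Hd; [lra|assumption].
    + destruct (Req_EM_T t0 t0) as [_|n]; [trivial|now elim n].
    + apply filter_forall; intros t.
      destruct (Req_EM_T t t0) as [->|n]; [ring|field; lra].
  - intros (a & Ha & Hl & Hf) eps He.
    destruct (filter_and _ _ (proj2 (continuous_R_eps _ _) Ha eps He) Hf)
      as [d Hd].
    exists d; intros h Hh0 Hh.
    destruct (Hd (t0 + h)) as [H1 H2].
    { change (Rabs (t0 + h - t0) < d).
      now replace (t0 + h - t0) with h by ring. }
    rewrite H2, <- Hl.
    now replace (a (t0 + h) * (t0 + h - t0) / h) with (a (t0 + h)) by (now field).
Qed.

(** The remainder of [g] is spread over the two increments in proportion to
    [dx / (dx^2 + dy^2)] and [dy / (dx^2 + dy^2)]. *)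
Lemma caratheodory_2d (g : R -> R -> R) (X Y : R -> R) (t0 a b : R) :
  differentiable_pt_lim g (X t0) (Y t0) a b ->
  continuous X t0 -> continuous Y t0 ->
  exists p q : R -> R, continuous p t0 /\ continuous q t0 /\
    p t0 = a /\ q t0 = b /\
    forall t, g (X t) (Y t) - g (X t0) (Y t0)
              = p t * (X t - X t0) + q t * (Y t - Y t0).
Proof.
  intros Hg HX HY.
  set (r := fun t => g (X t) (Y t) - g (X t0) (Y t0)
                     - (a * (X t - X t0) + b * (Y t - Y t0))).
  set (n := fun t => (X t - X t0) ^ 2 + (Y t - Y t0) ^ 2).
  assert (Hn : forall t, n t = 0 -> X t = X t0 /\ Y t = Y t0).
  { intros t H0.
    assert (H1 : Rsqr (X t - X t0) + Rsqr (Y t - Y t0) = 0)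
      by (rewrite <- H0; unfold n, Rsqr; ring).
    destruct (Rplus_sqr_eq_0 _ _ H1); split; apply Rminus_diag_uniq; assumption. }
  assert (Hr : forall eps, 0 < eps -> locally t0 (fun t =>
     Rabs (r t * (X t - X t0) / n t) < eps /\
     Rabs (r t * (Y t - Y t0) / n t) < eps)).
  { intros eps He.
    assert (He2 : 0 < eps / 2) by lra.
    destruct (Hg (mkposreal _ He2)) as [d Hd]; simpl in Hd.
    generalize (filter_and _ _
      (proj2 (continuous_R_eps _ _) HX d (cond_pos d))
      (proj2 (continuous_R_eps _ _) HY d (cond_pos d))).
    apply filter_imp; intros t [H1 H2].
    specialize (Hd _ _ H1 H2); fold (r t) in Hd.
    assert (key : forall w, Rabs w <= Rmax (Rabs (X t - X t0)) (Rabs (Y t - Y t0)) ->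
      Rabs (r t * w / n t) < eps).
    { intros w Hw.
      set (m := Rmax (Rabs (X t - X t0)) (Rabs (Y t - Y t0))) in *.
      destruct (Req_dec (n t) 0) as [E|E].
      - destruct (Hn t E) as [E1 E2].
        assert (m = 0) as Em.
        { unfold m. rewrite E1, E2, !Rminus_diag, Rabs_R0. now apply Rmax_left, Rle_refl. }
        assert (w = 0) as ->.
        { rewrite Em in Hw. destruct (Req_dec w 0) as [?|Hw0]; trivial.
          apply Rabs_pos_lt in Hw0; lra. }
        unfold Rdiv; rewrite Rmult_0_r, Rmult_0_l, Rabs_R0; assumption.
      - assert (Hpos : 0 < n t).
        { assert (0 <= n t) by (apply Rplus_le_le_0_compat; apply pow2_ge_0). lra. }
        assert (Hm : m * m <= n t).
        { unfold m, n. rewrite <- (pow2_abs (X t - X t0)), <- (pow2_abs (Y t - Y t0)).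
          generalize (Rabs_pos (X t - X t0)) (Rabs_pos (Y t - Y t0)).
          unfold Rmax; destruct Rle_dec; nra. }
        unfold Rdiv; rewrite !Rabs_mult, Rabs_inv, (Rabs_pos_eq (n t)) by lra.
        apply Rle_lt_trans with (eps / 2); [|lra].
        apply (Rmult_le_reg_r (n t)); trivial.
        rewrite Rmult_assoc, Rinv_l, Rmult_1_r by lra.
        apply Rle_trans with ((eps / 2 * m) * m).
        + apply Rmult_le_compat; trivial; apply Rabs_pos.
        + rewrite Rmult_assoc. apply Rmult_le_compat_l; lra. }
    split; apply key; [apply Rmax_l | apply Rmax_r]. }
  exists (fun t => a + r t * (X t - X t0) / n t),
         (fun t => b + r t * (Y t - Y t0) / n t).
  split; [|split; [|split; [|split]]].
  - apply continuous_R_eps; intros eps He.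
    generalize (Hr eps He); apply filter_imp; intros t [H _].
    rewrite (Rminus_diag (X t0)).
    replace (_ - _) with (r t * (X t - X t0) / n t) by (unfold Rdiv; ring).
    exact H.
  - apply continuous_R_eps; intros eps He.
    generalize (Hr eps He); apply filter_imp; intros t [_ H].
    rewrite (Rminus_diag (Y t0)).
    replace (_ - _) with (r t * (Y t - Y t0) / n t) by (unfold Rdiv; ring).
    exact H.
  - rewrite Rminus_diag; unfold Rdiv; ring.
  - rewrite Rminus_diag; unfold Rdiv; ring.
  - intros t; destruct (Req_dec (n t) 0) as [E|E].
    + destruct (Hn t E) as [-> ->]; ring.
    + replace (_ + _) with
        (a * (X t - X t0) + b * (Y t - Y t0) + r t * n t / n t)
        by (unfold n at 1; field; exact E).
      unfold Rdiv; rewrite Rmult_assoc, Rinv_r by exact E; unfold r; ring.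
Qed.

(** The derivative part of the inverse function theorem, along one curve: at each
    [t] the increments of [X] and [Y] solve a 2 x 2 linear system whose
    coefficients are continuous at [t0] and whose determinant is nonzero there. *)
Lemma curve_derivative (g1 g2 : R -> R -> R) (X Y : R -> R)
    (t0 a b c d al be : R) :
  differentiable_pt_lim g1 (X t0) (Y t0) a b ->
  differentiable_pt_lim g2 (X t0) (Y t0) c d ->
  a * d - b * c <> 0 ->
  continuous X t0 -> continuous Y t0 ->
  is_derive (fun t => g1 (X t) (Y t)) t0 al ->
  is_derive (fun t => g2 (X t) (Y t)) t0 be ->
  is_derive X t0 ((d * al - b * be) / (a * d - b * c)) /\
  is_derive Y t0 ((a * be - c * al) / (a * d - b * c)).
Proof.
  intros H1 H2 Hdet HX HY D1 D2.
  destruct (caratheodory_2d _ _ _ _ _ _ H1 HX HY) as (p1 & q1 & Cp1 & Cq1 & Ep1 & Eq1 & F1).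
  destruct (caratheodory_2d _ _ _ _ _ _ H2 HX HY) as (p2 & q2 & Cp2 & Cq2 & Ep2 & Eq2 & F2).
  destruct (proj1 (caratheodory_1d _ _ _) D1) as (a1 & Ca1 & Ea1 & G1).
  destruct (proj1 (caratheodory_1d _ _ _) D2) as (a2 & Ca2 & Ea2 & G2).
  set (det := fun t => p1 t * q2 t - q1 t * p2 t).
  assert (Cdet : continuous det t0).
  { apply continuous_Rminus; apply continuous_Rmult; assumption. }
  assert (Edet : det t0 = a * d - b * c) by (unfold det; congruence).
  assert (Ndet : locally t0 (fun t => det t <> 0)).
  { generalize (proj2 (continuous_R_eps _ _) Cdet (Rabs (det t0)) ltac:(apply Rabs_pos_lt; congruence)).
    apply filter_imp; intros t Ht E; rewrite E in Ht.
    rewrite Rminus_0_l, Rabs_Ropp in Ht; lra. }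
  assert (Cinv : continuous (fun t => / det t) t0).
  { apply continuous_Rinv; trivial; congruence. }
  split; apply caratheodory_1d.
  - exists (fun t => (q2 t * a1 t - q1 t * a2 t) * / det t); repeat split.
    + apply continuous_Rmult; trivial.
      apply continuous_Rminus; apply continuous_Rmult; assumption.
    + rewrite Edet; unfold Rdiv; congruence.
    + generalize (filter_and _ _ Ndet (filter_and _ _ G1 G2)).
      apply filter_imp; intros t (Hd & E1 & E2).
      rewrite F1 in E1; rewrite F2 in E2.
      apply (Rmult_eq_reg_l (det t)); trivial.
      transitivity (q2 t * (a1 t * (t - t0)) - q1 t * (a2 t * (t - t0))).
      * rewrite <- E1, <- E2; unfold det; ring.
      * field; trivial.
  - exists (fun t => (p1 t * a2 t - p2 t * a1 t) * / det t); repeat split.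
    + apply continuous_Rmult; trivial.
      apply continuous_Rminus; apply continuous_Rmult; assumption.
    + rewrite Edet; unfold Rdiv; congruence.
    + generalize (filter_and _ _ Ndet (filter_and _ _ G1 G2)).
      apply filter_imp; intros t (Hd & E1 & E2).
      rewrite F1 in E1; rewrite F2 in E2.
      apply (Rmult_eq_reg_l (det t)); trivial.
      transitivity (p1 t * (a2 t * (t - t0)) - p2 t * (a1 t * (t - t0))).
      * rewrite <- E1, <- E2; unfold det; ring.
      * field; trivial.
Qed.

(** Values of [g a0] slightly above and below [k0] trap [beta]: the strict
    inequalities at [beta a0 k0 - e] and [beta a0 k0 + e] persist for nearby
    [a] and [k], and monotonicity turns them into bounds on [beta a k]. *)
Lemma decreasing_inverse_continuity (g : R -> R -> R) (D : R -> R -> Prop)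
    (beta : R -> R -> R) (a0 k0 : R) :
  (forall b, D a0 b -> locally a0 (fun a => D a b)) ->
  locally (beta a0 k0) (D a0) ->
  (forall b, D a0 b -> continuous (fun a => g a b) a0) ->
  (forall a b1 b2, D a b1 -> D a b2 -> b1 < b2 -> g a b2 < g a b1) ->
  locally_2d (fun a k => D a (beta a k) /\ g a (beta a k) = k) a0 k0 ->
  continuity_2d_pt beta a0 k0.
Proof.
  intros Hopen HD Hc Hdec Hb eps.
  set (b0 := beta a0 k0) in *.
  destruct HD as [r Hr].
  set (e := Rmin (eps / 2) (r / 2)).
  assert (He : 0 < e) by (apply Rmin_pos; generalize (cond_pos eps) (cond_pos r); lra).
  assert (He1 : e < eps) by (generalize (Rmin_l (eps / 2) (r / 2)) (cond_pos eps); fold e; lra).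
  assert (He2 : e < r) by (generalize (Rmin_r (eps / 2) (r / 2)) (cond_pos r); fold e; lra).
  assert (Dm : D a0 (b0 - e)).
  { apply Hr; change (Rabs (b0 - e - b0) < r).
    replace (b0 - e - b0) with (- e) by ring. rewrite Rabs_Ropp, Rabs_pos_eq; lra. }
  assert (Dp : D a0 (b0 + e)).
  { apply Hr; change (Rabs (b0 + e - b0) < r).
    replace (b0 + e - b0) with e by ring. rewrite Rabs_pos_eq; lra. }
  destruct (locally_2d_singleton _ _ _ Hb) as [D0 E0]; fold b0 in D0, E0.
  assert (L1 : k0 < g a0 (b0 - e)) by (rewrite <- E0; apply Hdec; trivial; lra).
  assert (L2 : g a0 (b0 + e) < k0) by (rewrite <- E0; apply Hdec; trivial; lra).
  set (d := Rmin ((g a0 (b0 - e) - k0) / 2) ((k0 - g a0 (b0 + e)) / 2)).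
  assert (Hd : 0 < d) by (apply Rmin_pos; lra).
  assert (Hd1 : d <= (g a0 (b0 - e) - k0) / 2) by apply Rmin_l.
  assert (Hd2 : d <= (k0 - g a0 (b0 + e)) / 2) by apply Rmin_r.
  destruct (filter_and _ _ (filter_and _ _ (Hopen _ Dm) (Hopen _ Dp))
    (filter_and _ _
      (proj2 (continuous_R_eps _ _) (Hc _ Dm) d Hd)
      (proj2 (continuous_R_eps _ _) (Hc _ Dp) d Hd))) as [r1 Hr1].
  destruct Hb as [r2 Hr2].
  assert (Hmin : 0 < Rmin (Rmin r1 r2) d)
    by (apply Rmin_pos; [apply Rmin_pos; apply cond_pos|exact Hd]).
  exists (mkposreal _ Hmin); simpl; intros a k Ha Hk.
  generalize (Rmin_l (Rmin r1 r2) d) (Rmin_r (Rmin r1 r2) d)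
    (Rmin_l r1 r2) (Rmin_r r1 r2); intros M1 M2 M3 M4.
  destruct (Hr1 a) as [[Da1 Da2] [Ca1 Ca2]].
  { change (Rabs (a - a0) < r1); lra. }
  destruct (Hr2 a k) as [Dak Eak]; [lra..|].
  apply Rabs_def2 in Ca1; apply Rabs_def2 in Ca2.
  assert (Hk' : Rabs (k - k0) < d) by lra.
  apply Rabs_def2 in Hk'.
  apply Rle_lt_trans with e; [|lra].
  apply Rabs_le; split.
  - destruct (Rle_or_lt (b0 - e) (beta a k)) as [?|Hlt]; [lra|].
    generalize (Hdec a _ _ Dak Da1 Hlt); lra.
  - destruct (Rle_or_lt (beta a k) (b0 + e)) as [?|Hlt]; [lra|].
    generalize (Hdec a _ _ Da2 Dak Hlt); lra.
Qed.

Lemma is_derive_0_const (f : R -> R) (a b : R) :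
  (forall z, Rmin a b <= z <= Rmax a b -> is_derive f z 0) -> f a = f b.
Proof.
  intros H; destruct (MVT_gen f a b (fun _ => 0)) as (z & _ & Hz).
  - intros z Hz; apply H; lra.
  - intros z Hz; apply continuity_pt_filterlim, (is_derive_continuous f z 0), H, Hz.
  - lra.
Qed.

Lemma is_derive_neg_decreasing (f df : R -> R) (a b : R) :
  a < b -> (forall z, a <= z <= b -> is_derive f z (df z)) ->
  (forall z, a <= z <= b -> df z < 0) -> f b < f a.
Proof.
  intros Hab Hd Hn; destruct (MVT_gen f a b df) as (z & Hz & E).
  - intros z Hz; rewrite Rmin_left, Rmax_right in Hz by lra; apply Hd; lra.
  - intros z Hz; rewrite Rmin_left, Rmax_right in Hz by lra.
    apply continuity_pt_filterlim, (is_derive_continuous f z (df z)), Hd, Hz.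
  - rewrite Rmin_left, Rmax_right in Hz by lra.
    specialize (Hn z Hz); nra.
Qed.

Lemma differentiable_of_partials (f fx : R -> R -> R) (fy x y : R) :
  locally_2d (fun s t => is_derive (fun z => f z t) s (fx s t)) x y ->
  continuity_2d_pt fx x y -> is_derive (fun z => f x z) y fy ->
  differentiable_pt_lim f x y (fx x y) fy.
Proof.
  intros H1 H2 H3; apply filterdiff_differentiable_pt_lim.
  apply (is_derive_filterdiff f x y fx fy); trivial.
  - now apply locally_2d_locally in H1.
  - now apply continuity_2d_pt_filterlim in H2.
Qed.

(** * Midpoint convexity *)

(** At a point where [f] exceeds its chord the most, the midpoint inequality with
    the nearer endpoint, where the excess is zero, forces that maximum to be at
    most half of itself. *)
Lemma midpoint_convex_pos (f : R -> R) :
  (forall p, 0 < p -> continuous f p) ->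
  (forall a b, 0 < a -> 0 < b -> f ((a + b) / 2) <= (f a + f b) / 2) ->
  convex_pos f.
Proof.
  intros Hc Hm a b s Ha Hb Hs.
  set (g := fun s => f (s * a + (1 - s) * b) - (s * f a + (1 - s) * f b)).
  assert (Hpos : forall s, 0 <= s <= 1 -> 0 < s * a + (1 - s) * b).
  { intros z Hz; destruct (Rle_or_lt z (/ 2)); nra. }
  assert (Hg : forall z, 0 <= z <= 1 -> continuity_pt g z).
  { intros z Hz; apply continuity_pt_filterlim; change (continuous g z); unfold g.
    apply continuous_Rminus.
    - apply (continuous_comp (fun s => s * a + (1 - s) * b) f).
      + apply @ex_derive_continuous; auto_derive; trivial.
      + apply Hc, Hpos, Hz.
    - apply @ex_derive_continuous; auto_derive; trivial. }
  destruct (continuity_ab_maj g 0 1 ltac:(lra) Hg) as (m & Hmax & Hm01).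
  assert (g0 : g 0 = 0).
  { unfold g; replace (0 * a + (1 - 0) * b) with b by ring; ring. }
  assert (g1 : g 1 = 0).
  { unfold g; replace (1 * a + (1 - 1) * b) with a by ring; ring. }
  assert (gm : forall z w, 0 <= z <= 1 -> 0 <= w <= 1 ->
      g ((z + w) / 2) <= (g z + g w) / 2).
  { intros z w Hz Hw; unfold g.
    generalize (Hm _ _ (Hpos z Hz) (Hpos w Hw)).
    replace ((z * a + (1 - z) * b + (w * a + (1 - w) * b)) / 2)
      with ((z + w) / 2 * a + (1 - (z + w) / 2) * b) by field.
    lra. }
  enough (g m <= 0) by (generalize (Hmax s Hs); unfold g at 1; lra).
  (* [m] is the midpoint of its nearer endpoint and of [2 m] or [2 m - 1]. *)
  destruct (Rle_or_lt m (/ 2)).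
  - generalize (gm 0 (2 * m) ltac:(lra) ltac:(lra)) (Hmax (2 * m) ltac:(lra)).
    replace ((0 + 2 * m) / 2) with m by field. lra.
  - generalize (gm 1 (2 * m - 1) ltac:(lra) ltac:(lra)) (Hmax (2 * m - 1) ltac:(lra)).
    replace ((1 + (2 * m - 1)) / 2) with m by field. lra.
Qed.

(** A convex function that increases somewhere grows at least linearly. *)
Lemma convex_pos_bounded_nonincreasing (f : R -> R) (p0 K : R) :
  convex_pos f -> (forall p, p0 < p -> f p <= K) -> nonincreasing_pos f.
Proof.
  intros Hf HK a b Ha Hab.
  destruct (Rle_or_lt (f b) (f a)) as [?|Hlt]; trivial.
  destruct Hab as [Hab| ->]; [|lra].
  (* If [f b > f a], extending the chord by the factor [t] goes past [p0] and
     above [K]. *)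
  set (t := 1 + Rabs p0 / (b - a) + Rabs (K - f a) / (f b - f a)).
  assert (H1 : 0 <= Rabs p0 / (b - a))
    by (apply Rdiv_le_0_compat; [apply Rabs_pos|lra]).
  assert (H2 : 0 <= Rabs (K - f a) / (f b - f a))
    by (apply Rdiv_le_0_compat; [apply Rabs_pos|lra]).
  assert (Ht : 1 <= t) by (unfold t; lra).
  assert (Ht1 : Rabs p0 < t * (b - a) + a).
  { replace (Rabs p0) with (Rabs p0 / (b - a) * (b - a)) by (field; lra).
    unfold t; nra. }
  assert (Ht2 : Rabs (K - f a) < t * (f b - f a)).
  { replace (Rabs (K - f a)) with (Rabs (K - f a) / (f b - f a) * (f b - f a))
      at 1 by (field; lra).
    unfold t; nra. }
  set (z := a + t * (b - a)).
  assert (Hz : 0 < z) by (unfold z; nra).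
  assert (Ht' : 0 <= / t <= 1).
  { split; [left; apply Rinv_0_lt_compat; lra|].
    rewrite <- Rinv_1; apply Rinv_le_contravar; lra. }
  generalize (Hf z a (/ t) Hz Ha Ht').
  replace (/ t * z + (1 - / t) * a) with b by (unfold z; field; lra).
  intros H.
  assert (Hfz : f z <= K).
  { apply HK; unfold z; generalize (Rle_abs p0); lra. }
  apply (Rmult_le_compat_l t) in H; [|lra].
  replace (t * (/ t * f z + (1 - / t) * f a)) with (f z + (t - 1) * f a) in H
    by (field; lra).
  generalize (Rle_abs (K - f a)); lra.
Qed.

Lemma log_midpoint_convex (f : R -> R) :
  (forall p, 0 < p -> continuous f p) ->
  (forall p, 0 < p -> 0 <= f p) ->
  (forall a b, 0 < a -> 0 < b -> f ((a + b) / 2) ^ 2 <= f a * f b) ->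
  convex_pos f /\
  ((forall p, 0 < p -> 0 < f p) -> convex_pos (fun p => ln (f p))).
Proof.
  intros Hc H0 Hm; split.
  - apply midpoint_convex_pos; trivial.
    intros a b Ha Hb.
    generalize (Hm a b Ha Hb) (H0 a Ha) (H0 b Hb); intros H1 H2 H3.
    apply Rsqr_incr_0_var; [|lra].
    generalize (pow2_ge_0 (f a - f b)); unfold Rsqr; nra.
  - intros Hpos; apply midpoint_convex_pos.
    + intros p Hp; apply (continuous_comp f ln); auto.
      apply @ex_derive_continuous; auto_derive; auto.
    + intros a b Ha Hb.
      assert (Hab : 0 < (a + b) / 2) by lra.
      generalize (Hm a b Ha Hb) (Hpos a Ha) (Hpos b Hb) (Hpos _ Hab);
        intros H1 H2 H3 H4.
      assert (H5 : ln (f ((a + b) / 2) ^ 2) <= ln (f a * f b)).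
      { apply ln_le; trivial. apply pow_lt; trivial. }
      rewrite ln_mult in H5 by trivial.
      simpl in H5; rewrite Rmult_1_r, ln_mult in H5 by trivial.
      lra.
Qed.

(** A zero at [a] is a zero at every midpoint of [a] and a second positive
    number, thus on all of [(a / 2, +oo)]; repeating this reaches every [p > 0]. *)
Lemma log_midpoint_convex_zero (f : R -> R) (p0 : R) :
  (forall p, 0 < p -> 0 <= f p) ->
  (forall a b, 0 < a -> 0 < b -> f ((a + b) / 2) ^ 2 <= f a * f b) ->
  0 < p0 -> f p0 = 0 -> forall p, 0 < p -> f p = 0.
Proof.
  intros H0 Hm Hp0 Hf p Hp.
  assert (step : forall a b, 0 < a -> f a = 0 -> a / 2 < b -> f b = 0).
  { intros a b Ha E Hb.
    generalize (Hm a (2 * b - a) Ha ltac:(lra)).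
    replace ((a + (2 * b - a)) / 2) with b by field.
    rewrite E; intros; generalize (H0 b ltac:(lra)); nra. }
  (* Any ratio in (1/2, 1) is admissible for one step; 3/4 is one. *)
  assert (all : forall n a, p0 * (3 / 4) ^ n <= a -> f a = 0).
  { induction n as [|n IH]; intros a Ha.
    - simpl in Ha. apply (step p0); trivial; lra.
    - assert (Hn : 0 < p0 * (3 / 4) ^ n)
        by (apply Rmult_lt_0_compat; trivial; apply pow_lt; lra).
      apply (step (p0 * (3 / 4) ^ n)); trivial.
      + apply IH; lra.
      + simpl in Ha; lra. }
  destruct (pow_lt_1_zero (3 / 4) ltac:(rewrite Rabs_pos_eq; lra) (p / p0)
    ltac:(apply Rdiv_lt_0_compat; trivial)) as [n Hn].
  specialize (Hn n ltac:(auto)).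
  apply (all n).
  rewrite Rabs_pos_eq in Hn by (apply pow_le; lra).
  apply (Rmult_lt_compat_l p0) in Hn; trivial.
  replace (p0 * (p / p0)) with p in Hn by (field; lra). lra.
Qed.

(** * Means of periodic holomorphic functions on horizontal lines *)

Lemma quadratic_nonneg_discriminant (a b i : R) :
  0 <= a -> (forall t, 0 <= a * t ^ 2 - 2 * i * t + b) -> i ^ 2 <= a * b.
Proof.
  intros Ha H; destruct (Req_dec a 0) as [->|Hne].
  - destruct (Req_dec i 0) as [->|Hi]; [lra|].
    generalize (H ((b + 1) / (2 * i))).
    replace (2 * i * ((b + 1) / (2 * i))) with (b + 1) by (field; trivial).
    lra.
  - generalize (H (i / a)).
    replace (a * (i / a) ^ 2 - 2 * i * (i / a) + b) with ((a * b - i ^ 2) / a)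
      by (field; trivial).
    intros H1; apply (Rmult_le_compat_l a) in H1; trivial.
    replace (a * ((a * b - i ^ 2) / a)) with (a * b - i ^ 2) in H1 by (field; trivial).
    lra.
Qed.

Lemma is_derive_RInt_C1 (f df : R -> R -> R) (a b x r : R) :
  0 < r ->
  (forall s q, Rabs (s - x) < r -> is_derive (fun s => f s q) s (df s q)) ->
  (forall s q, Rabs (s - x) < r -> continuity_2d_pt df s q) ->
  (forall s q, Rabs (s - x) < r -> continuous (f s) q) ->
  is_derive (fun s => RInt (f s) a b) x (RInt (df x) a b).
Proof.
  intros Hr Hd Hdc Hc.
  assert (Hx : Rabs (x - x) < r) by (rewrite Rminus_diag, Rabs_R0; trivial).
  replace (RInt (df x) a b) with (RInt (fun q => Derive (fun s => f s q) x) a b).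
  2: { apply RInt_ext; intros q _; apply is_derive_unique, Hd, Hx. }
  apply (is_derive_RInt_param f).
  - exists (mkposreal r Hr); intros s Hs q _; eexists; apply Hd, Hs.
  - intros q _. apply continuity_2d_pt_ext_loc with df.
    + exists (mkposreal r Hr); intros s z Hs _; symmetry.
      apply is_derive_unique, Hd, Hs.
    + apply Hdc, Hx.
  - exists (mkposreal r Hr); intros s Hs.
    apply @ex_RInt_continuous; intros z _; apply Hc, Hs.
Qed.

Lemma is_derive_sum_of_products (f1 g1 f2 g2 : R -> R) (t d1 e1 d2 e2 : R) :
  is_derive f1 t d1 -> is_derive g1 t e1 ->
  is_derive f2 t d2 -> is_derive g2 t e2 ->
  is_derive (fun t => f1 t * g1 t + f2 t * g2 t) t
    (d1 * g1 t + f1 t * e1 + (d2 * g2 t + f2 t * e2)).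
Proof.
  intros H1 H2 H3 H4.
  apply (is_derive_plus (fun t => f1 t * g1 t) (fun t => f2 t * g2 t)).
  - now apply (is_derive_mult f1 g1); [| |apply Rmult_comm].
  - now apply (is_derive_mult f2 g2); [| |apply Rmult_comm].
Qed.

(** [A + i B] is a holomorphic function of [q + i p] on the upper half plane,
    [L]-periodic in [q], and [al + i be] is its derivative. *)
Section ThreeLines.

Variables (A B al be : R -> R -> R) (L : R).
Hypothesis HL : 0 < L.
Hypothesis Aq : forall q p, 0 < p -> is_derive (fun q => A q p) q (al q p).
Hypothesis Bq : forall q p, 0 < p -> is_derive (fun q => B q p) q (be q p).
Hypothesis Ap : forall q p, 0 < p -> is_derive (fun p => A q p) p (- be q p).
Hypothesis Bp : forall q p, 0 < p -> is_derive (fun p => B q p) p (al q p).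
Hypothesis Ac : forall q p, 0 < p -> continuity_2d_pt A q p.
Hypothesis Bc : forall q p, 0 < p -> continuity_2d_pt B q p.
Hypothesis alc : forall q p, 0 < p -> continuity_2d_pt al q p.
Hypothesis bec : forall q p, 0 < p -> continuity_2d_pt be q p.
Hypothesis Aper : forall q p, 0 < p -> A (q + L) p = A q p.
Hypothesis Bper : forall q p, 0 < p -> B (q + L) p = B q p.

(** The real part of [int_0^L F(q, p) conj (F(q, r)) dq] for [F = A + i B]. *)
Definition line_pairing (p r : R) : R :=
  RInt (fun q => A q p * A q r + B q p * B q r) 0 L.

Lemma line_pairing_integrand_continuous (p r q : R) : 0 < p -> 0 < r ->
  continuous (fun q => A q p * A q r + B q p * B q r) q.
Proof.
  intros Hp Hr; apply continuous_Rplus; apply continuous_Rmult;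
    apply (continuity_2d_pt_slice_l _ q); auto.
Qed.

Lemma ex_RInt_line_pairing (p r : R) : 0 < p -> 0 < r ->
  ex_RInt (fun q => A q p * A q r + B q p * B q r) 0 L.
Proof.
  intros Hp Hr; apply @ex_RInt_continuous; intros q _.
  now apply line_pairing_integrand_continuous.
Qed.

(** As [F_p = i F_q], the [s]-derivative of [F(q, m + s) conj (F(q, m - s))] is
    [i] times the [q]-derivative of the same product, whose integral over a
    period vanishes.  In Fourier terms, the factors [exp (- n k (m + s))] and
    [exp (- n k (m - s))] of the [n]-th mode multiply to [exp (- 2 n k m)]. *)
Lemma line_pairing_reflection (m s : R) : Rabs s < m ->
  line_pairing (m + s) (m - s) = line_pairing m m.
Proof.
  intros Hs.
  set (D := fun s q => (al q (m + s) * B q (m - s) + A q (m + s) * be q (m - s))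
               - (be q (m + s) * A q (m - s) + B q (m + s) * al q (m - s))).
  assert (Hder : forall s, Rabs s < m ->
     is_derive (fun s => line_pairing (m + s) (m - s)) s 0).
  { intros z Hz.
    assert (Hrange : forall s, Rabs (s - z) < m - Rabs z -> 0 < m + s /\ 0 < m - s).
    { intros w Hw.
      assert (Rabs w < m).
      { replace w with ((w - z) + z) by ring.
        eapply Rle_lt_trans; [apply Rabs_triang|lra]. }
      apply Rabs_def2 in H; lra. }
    replace 0 with (RInt (D z) 0 L).
    - apply (is_derive_RInt_C1
        (fun s q => A q (m + s) * A q (m - s) + B q (m + s) * B q (m - s)) D
        0 L z (m - Rabs z)); [lra|..].
      + intros w q Hw; destruct (Hrange w Hw) as [H1 H2].
        assert (dA1 : is_derive (fun s => A q (m + s)) w (1 * - be q (m + w))).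
        { apply (is_derive_comp (fun p => A q p) (fun s => m + s)); [auto|].
          auto_derive; trivial; ring. }
        assert (dA2 : is_derive (fun s => A q (m - s)) w (- 1 * - be q (m - w))).
        { apply (is_derive_comp (fun p => A q p) (fun s => m - s)); [auto|].
          auto_derive; trivial; ring. }
        assert (dB1 : is_derive (fun s => B q (m + s)) w (1 * al q (m + w))).
        { apply (is_derive_comp (fun p => B q p) (fun s => m + s)); [auto|].
          auto_derive; trivial; ring. }
        assert (dB2 : is_derive (fun s => B q (m - s)) w (- 1 * al q (m - w))).
        { apply (is_derive_comp (fun p => B q p) (fun s => m - s)); [auto|].
          auto_derive; trivial; ring. }
        replace (D w q) with
          (1 * - be q (m + w) * A q (m - w)
           + A q (m + w) * (- 1 * - be q (m - w))
           + (1 * al q (m + w) * B q (m - w)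
              + B q (m + w) * (- 1 * al q (m - w)))) by (unfold D; ring).
        exact (is_derive_sum_of_products _ _ _ _ _ _ _ _ _ dA1 dA2 dB1 dB2).
      + intros w q Hw; destruct (Hrange w Hw) as [H1 H2].
        assert (up : forall F, continuity_2d_pt F q (m + w) ->
            continuity_2d_pt (fun s q => F q (m + s)) w q).
        { intros F HF; apply (continuity_2d_pt_comp F (fun _ q => q) (fun s _ => m + s)); trivial.
          - apply continuity_2d_pt_id2.
          - apply continuity_2d_pt_plus;
              [apply continuity_2d_pt_const|apply continuity_2d_pt_id1]. }
        assert (dn : forall F, continuity_2d_pt F q (m - w) ->
            continuity_2d_pt (fun s q => F q (m - s)) w q).
        { intros F HF; apply (continuity_2d_pt_comp F (fun _ q => q) (fun s _ => m - s)); trivial.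
          - apply continuity_2d_pt_id2.
          - apply continuity_2d_pt_minus;
              [apply continuity_2d_pt_const|apply continuity_2d_pt_id1]. }
        apply continuity_2d_pt_minus; apply continuity_2d_pt_plus;
          apply continuity_2d_pt_mult; auto.
      + intros w q Hw; destruct (Hrange w Hw) as [H1 H2].
        now apply line_pairing_integrand_continuous.
    - (* [G] is the imaginary part of [F(q, m - z)] times the conjugate of
         [F(q, m + z)]. *)
      apply Rabs_def2 in Hz.
      apply is_RInt_unique.
      set (G := fun q => A q (m + z) * B q (m - z) - B q (m + z) * A q (m - z)).
      replace 0 with (minus (G L) (G 0)) at 2.
      2: { unfold G, minus, plus, opp; simpl.
           rewrite <- (Rplus_0_l L) at 1 2 3 4.
           rewrite !Aper, !Bper by lra. ring. }
      apply (is_RInt_derive G (D z)).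
      + intros q _; unfold G, D.
        assert (H1 : 0 < m + z) by lra. assert (H2 : 0 < m - z) by lra.
        apply (is_derive_minus (fun q => A q (m + z) * B q (m - z))
          (fun q => B q (m + z) * A q (m - z)));
          [apply (is_derive_mult (fun q => A q (m + z)) (fun q => B q (m - z)))
          |apply (is_derive_mult (fun q => B q (m + z)) (fun q => A q (m - z)))];
          solve [auto | apply Rmult_comm].
      + intros q _; unfold D.
        assert (H1 : 0 < m + z) by lra. assert (H2 : 0 < m - z) by lra.
        apply continuous_Rminus; apply continuous_Rplus; apply continuous_Rmult;
          apply (continuity_2d_pt_slice_l _ q); auto. }
  assert (E : line_pairing (m + s) (m - s) = line_pairing (m + 0) (m - 0)).
  { apply (is_derive_0_const (fun s => line_pairing (m + s) (m - s))).
    intros z Hz; apply Hder, Rle_lt_trans with (Rabs s); trivial.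
    unfold Rmin, Rmax in Hz; destruct Rle_dec; unfold Rabs;
      repeat destruct Rcase_abs; lra. }
  now rewrite Rplus_0_r, Rminus_0_r in E.
Qed.

Lemma line_pairing_nonneg (p : R) : 0 < p -> 0 <= line_pairing p p.
Proof.
  intros Hp; apply RInt_ge_0; [lra|now apply ex_RInt_line_pairing|].
  intros q _; nra.
Qed.

Lemma line_pairing_cauchy_schwarz (p r : R) : 0 < p -> 0 < r ->
  line_pairing p r ^ 2 <= line_pairing p p * line_pairing r r.
Proof.
  intros Hp Hr; apply quadratic_nonneg_discriminant.
  - now apply line_pairing_nonneg.
  - intros t.
    generalize (RInt_correct _ _ _ (ex_RInt_line_pairing p p Hp Hp))
      (RInt_correct _ _ _ (ex_RInt_line_pairing p r Hp Hr))
      (RInt_correct _ _ _ (ex_RInt_line_pairing r r Hr Hr)).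
    fold (line_pairing p p) (line_pairing p r) (line_pairing r r).
    intros I1 I2 I3.
    generalize (is_RInt_plus _ _ _ _ _ _
      (is_RInt_minus _ _ _ _ _ _ (is_RInt_scal _ _ _ (t ^ 2) _ I1)
         (is_RInt_scal _ _ _ (2 * t) _ I2)) I3).
    intros I.
    replace (line_pairing p p * t ^ 2 - 2 * line_pairing p r * t + line_pairing r r)
      with (plus (minus (scal (t ^ 2) (line_pairing p p))
        (scal (2 * t) (line_pairing p r))) (line_pairing r r))
      by (unfold plus, minus, scal, opp; simpl; unfold mult; simpl; unfold plus; simpl; ring).
    apply (is_RInt_ge_0 _ 0 L _ ltac:(lra) I).
    intros q _; unfold plus, minus, scal, opp; simpl; unfold mult; simpl; unfold plus; simpl.
    match goal with |- 0 <= ?e => replace e with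
      ((t * A q p - A q r) ^ 2 + (t * B q p - B q r) ^ 2) by ring end.
    apply Rplus_le_le_0_compat; apply pow2_ge_0.
Qed.

(** The lines at heights [a] and [b] are reflections of each other in the line at
    height [(a + b) / 2]. *)
Lemma line_mean_log_midpoint (a b : R) : 0 < a -> 0 < b ->
  line_pairing ((a + b) / 2) ((a + b) / 2) ^ 2
    <= line_pairing a a * line_pairing b b.
Proof.
  intros Ha Hb.
  rewrite <- (line_pairing_reflection ((a + b) / 2) ((a - b) / 2))
    by (apply Rabs_def1; lra).
  replace ((a + b) / 2 + (a - b) / 2) with a by field.
  replace ((a + b) / 2 - (a - b) / 2) with b by field.
  now apply line_pairing_cauchy_schwarz.
Qed.

Lemma line_mean_continuous (p : R) : 0 < p ->
  continuous (fun p => line_pairing p p) p.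
Proof.
  intros Hp.
  assert (Hrange : forall s, Rabs (s - p) < p -> 0 < s)
    by (intros s Hs; apply Rabs_def2 in Hs; lra).
  assert (swap : forall F s q, continuity_2d_pt F q s ->
      continuity_2d_pt (fun s q => F q s) s q).
  { intros F s q HF; apply (continuity_2d_pt_comp F (fun _ q => q) (fun s _ => s)); trivial.
    - apply continuity_2d_pt_id2.
    - apply continuity_2d_pt_id1. }
  eapply is_derive_continuous; apply (is_derive_RInt_C1
    (fun p q => A q p * A q p + B q p * B q p)
    (fun p q => (- be q p * A q p + A q p * - be q p)
                + (al q p * B q p + B q p * al q p)) 0 L p p Hp).
  - intros s q Hs; apply Hrange in Hs.
    exact (is_derive_sum_of_products _ _ _ _ _ _ _ _ _
      (Ap q s Hs) (Ap q s Hs) (Bp q s Hs) (Bp q s Hs)).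
  - intros s q Hs; apply Hrange in Hs.
    apply continuity_2d_pt_plus; apply continuity_2d_pt_plus;
      apply continuity_2d_pt_mult; try apply continuity_2d_pt_opp; auto.
  - intros s q Hs; apply Hrange in Hs.
    now apply line_pairing_integrand_continuous.
Qed.

End ThreeLines.

(** * Periodic functions *)

Lemma periodic_IZR (f : R -> R) (l : R) (k : Z) :
  (forall x, f (x + l) = f x) -> forall x, f (x + IZR k * l) = f x.
Proof.
  intros H x.
  assert (Hn : forall n z, f (z + INR n * l) = f z).
  { induction n as [|n IH]; intros z.
    - simpl; f_equal; ring.
    - rewrite S_INR. replace (z + (INR n + 1) * l) with (z + INR n * l + l) by ring.
      now rewrite H. }
  destruct (Z_le_gt_dec 0 k) as [Hk|Hk].
  - rewrite <- (Z2Nat.id k), <- INR_IZR_INZ by trivial; apply Hn.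
  - rewrite <- (Hn (Z.to_nat (- k)) (x + IZR k * l)), INR_IZR_INZ, Z2Nat.id by lia.
    rewrite opp_IZR; f_equal; ring.
Qed.

Lemma continuous_periodic_bounded (f : R -> R) (l : R) :
  0 < l -> (forall x, continuous f x) -> (forall x, f (x + l) = f x) ->
  exists m M, forall x, m <= f x <= M.
Proof.
  intros Hl Hc Hp.
  assert (Hc' : forall z, 0 <= z <= l -> continuity_pt f z)
    by (intros z _; apply continuity_pt_filterlim, Hc).
  destruct (continuity_ab_maj f 0 l ltac:(lra) Hc') as (zM & HM & _).
  destruct (continuity_ab_min f 0 l ltac:(lra) Hc') as (zm & Hm & _).
  exists (f zm), (f zM); intros x.
  rewrite <- (periodic_IZR f l (- Int_part (x / l)) Hp x), opp_IZR.
  destruct (base_Int_part (x / l)) as [H1 H2].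
  set (k := IZR (Int_part (x / l))) in *.
  assert (E : x = x / l * l) by (field; lra).
  assert (0 <= x + - k * l <= l) by (split; nra).
  split; [apply Hm|apply HM]; trivial.
Qed.

Lemma RInt_periodic (f : R -> R) (l a : R) :
  (forall q, continuous f q) -> (forall q, f (q + l) = f q) ->
  RInt f a (a + l) = RInt f 0 l.
Proof.
  intros Hc Hp.
  assert (Hex : forall u v, ex_RInt f u v)
    by (intros; apply @ex_RInt_continuous; intros; apply Hc).
  generalize (RInt_Chasles f a 0 (a + l) (Hex _ _) (Hex _ _))
    (RInt_Chasles f 0 l (a + l) (Hex _ _) (Hex _ _)).
  assert (E : RInt f l (a + l) = RInt f 0 a).
  { generalize (RInt_comp_lin f 1 l 0 a (Hex _ _)).
    rewrite Rmult_0_r, Rplus_0_l, Rmult_1_l; intros <-.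
    apply RInt_ext; intros q _.
    change (1 * f (1 * q + l) = f q); now rewrite !Rmult_1_l, Hp. }
  generalize (RInt_Chasles f 0 a 0 (Hex _ _) (Hex _ _)); rewrite RInt_point.
  unfold plus, zero in *; simpl in *; rewrite E; lra.
Qed.

(** Were [f] positive at [q], its integral over the period starting at [q] would
    be positive. *)
Lemma RInt_periodic_zero (f : R -> R) (l : R) :
  0 < l -> (forall q, continuous f q) -> (forall q, f (q + l) = f q) ->
  (forall q, 0 <= f q) -> RInt f 0 l = 0 -> forall q, f q = 0.
Proof.
  intros Hl Hc Hp H0 HI q.
  destruct (Req_dec (f q) 0) as [?|Hne]; trivial; exfalso.
  assert (Hq : 0 < f q) by (generalize (H0 q); lra).
  destruct (proj2 (continuous_R_eps _ _) (Hc q) _ Hq) as [d Hd].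
  set (e := Rmin d l).
  assert (He : 0 < e) by (apply Rmin_pos; trivial; apply cond_pos).
  assert (Hex : forall u v, ex_RInt f u v)
    by (intros; apply @ex_RInt_continuous; intros; apply Hc).
  assert (I1 : 0 < RInt f q (q + e)).
  { apply RInt_gt_0; [lra| |intros; apply Hc].
    intros z Hz; assert (Rabs (z - q) < d).
    { generalize (Rmin_l d l); fold e; intros; rewrite Rabs_pos_eq; lra. }
    generalize (Hd z H); intros H1; apply Rabs_def2 in H1; lra. }
  assert (I2 : 0 <= RInt f (q + e) (q + l)).
  { apply RInt_ge_0; auto. generalize (Rmin_r d l); fold e; lra. }
  generalize (RInt_Chasles f q (q + e) (q + l) (Hex _ _) (Hex _ _)).
  rewrite (RInt_periodic f l q Hc Hp), HI; unfold plus; simpl; lra.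
Qed.

(** * Stream function and streamlines *)

Section Wave.

Variables (c lam g Patm : R) (eta : R -> R) (u v P psi xi : R -> R -> R).
Hypothesis Hwave : stokes_wave c lam g Patm eta u v P.
Hypothesis Hpsi : stream_function c eta u v psi.
Hypothesis Hxi : streamlines eta psi xi.

Let c_pos : 0 < c := sw_c _ _ _ _ _ _ _ _ Hwave.
Let lam_pos : 0 < lam := sw_lam _ _ _ _ _ _ _ _ Hwave.

Lemma eta_continuous (x : R) : continuous eta x.
Proof. apply @ex_derive_continuous, (sw_eta_diff _ _ _ _ _ _ _ _ Hwave). Qed.

Lemma below_surface_locally (x y : R) : y < eta x -> locally x (fun s => y < eta s).
Proof.
  intros H; generalize (proj2 (continuous_R_eps _ _) (eta_continuous x) (eta x - y) ltac:(lra)).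
  apply filter_imp; intros s Hs; apply Rabs_def2 in Hs; lra.
Qed.

Lemma fluid_open (x y : R) : fluid eta x y -> locally_2d (fluid eta) x y.
Proof.
  unfold fluid; intros H.
  set (m := (y + eta x) / 2).
  destruct (below_surface_locally x m ltac:(unfold m; lra)) as [d Hd].
  assert (Hm : 0 < Rmin d (m - y)) by (apply Rmin_pos; [apply cond_pos|unfold m; lra]).
  exists (mkposreal _ Hm); simpl; intros s t Hs Ht.
  generalize (Rmin_l d (m - y)) (Rmin_r d (m - y)); intros.
  assert (m < eta s) by (apply Hd; change (Rabs (s - x) < d); lra).
  apply Rabs_def2 in Ht; lra.
Qed.

Lemma fluid_differentiable (f : R -> R -> R) (x y : R) :
  C1_in (fluid eta) f -> fluid eta x y ->
  differentiable_pt_lim f x y (dx f x y) (dy f x y).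
Proof.
  intros Hf Hxy; apply differentiable_of_partials.
  - generalize (fluid_open x y Hxy); apply locally_2d_impl, locally_2d_forall.
    intros s t Hst; apply Derive_correct, (Hf s t Hst).
  - apply (Hf x y Hxy).
  - apply Derive_correct, (Hf x y Hxy).
Qed.

Lemma fluid_continuous (f : R -> R -> R) (x y : R) :
  C1_in (fluid eta) f -> fluid eta x y -> continuity_2d_pt f x y.
Proof.
  intros Hf Hxy; apply differentiable_continuity_pt.
  exists (dx f x y), (dy f x y); now apply fluid_differentiable.
Qed.

Let uC1 : C1_in (fluid eta) u := sw_u_C1 _ _ _ _ _ _ _ _ Hwave.
Let vC1 : C1_in (fluid eta) v := sw_v_C1 _ _ _ _ _ _ _ _ Hwave.

Lemma velocity_leftward (x y : R) : fluid eta x y -> u x y - c < 0.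
Proof.
  intros H; assert (u x y < c); [|lra].
  apply (sw_no_stagnation _ _ _ _ _ _ _ _ Hwave); unfold closed_fluid, fluid in *; lra.
Qed.

Lemma psi_differentiable (x y : R) : fluid eta x y ->
  differentiable_pt_lim psi x y (- v x y) (u x y - c).
Proof.
  intros Hxy; apply (differentiable_of_partials psi (fun s t => - v s t)).
  - generalize (fluid_open x y Hxy); apply locally_2d_impl, locally_2d_forall.
    intros s t Hst; now apply (sf_x _ _ _ _ _ Hpsi).
  - apply continuity_2d_pt_opp; now apply fluid_continuous.
  - now apply (sf_y _ _ _ _ _ Hpsi).
Qed.

Lemma psi_continuous (x y : R) : fluid eta x y -> continuity_2d_pt psi x y.
Proof.
  intros H; apply differentiable_continuity_pt; eexists; eexists.
  now apply psi_differentiable.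
Qed.

Lemma psi_decreasing (x y1 y2 : R) : fluid eta x y1 -> fluid eta x y2 ->
  y1 < y2 -> psi x y2 < psi x y1.
Proof.
  intros H1 H2 H; apply (is_derive_neg_decreasing _ (fun y => u x y - c)); trivial.
  - intros z Hz; apply (sf_y _ _ _ _ _ Hpsi); unfold fluid in *; lra.
  - intros z Hz; apply velocity_leftward; unfold fluid in *; lra.
Qed.

Lemma surface_limit (f : R -> R -> R) (x eps : R) :
  continuous_up_to_surface eta f -> 0 < eps ->
  exists d, 0 < d /\
    forall y, eta x - d < y <= eta x -> Rabs (f x y - f x (eta x)) < eps.
Proof.
  intros Hf He.
  assert (Hc : closed_fluid eta (fst (x, eta x)) (snd (x, eta x)))
    by (unfold closed_fluid; simpl; lra).
  destruct (proj1 (filterlim_locally _ _) (Hf (x, eta x) Hc) (mkposreal eps He)) as [d Hd].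
  exists d; split; [apply cond_pos|]; intros y Hy.
  apply (Hd (x, y)).
  - split; simpl; [apply ball_center|].
    change (Rabs (y - eta x) < d); apply Rabs_def1; lra.
  - unfold closed_fluid; simpl; lra.
Qed.

(** [psi] decreases upwards to its surface value [0]. *)
Lemma psi_pos (x y : R) : fluid eta x y -> 0 < psi x y.
Proof.
  unfold fluid; intros Hxy; set (z := (y + eta x) / 2).
  assert (psi x z < psi x y) by (apply psi_decreasing; unfold fluid, z; lra).
  destruct (Rle_or_lt 0 (psi x z)) as [?|Hn]; [lra|exfalso].
  destruct (surface_limit psi x (- psi x z) (sf_cont _ _ _ _ _ Hpsi) ltac:(lra)) as (d & Hd & Hlim).
  rewrite (sf_surface _ _ _ _ _ Hpsi) in Hlim.
  assert (Hw : exists w, eta x - d < w <= eta x /\ z < w < eta x).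
  { assert (z < eta x) by (unfold z; lra).
    exists (eta x - Rmin d (eta x - z) / 2).
    assert (0 < Rmin d (eta x - z)) by (apply Rmin_pos; lra).
    generalize (Rmin_l d (eta x - z)) (Rmin_r d (eta x - z)); lra. }
  destruct Hw as (w & Hw1 & Hw2).
  assert (psi x w < psi x z) by (apply psi_decreasing; unfold fluid; lra).
  specialize (Hlim w Hw1); apply Rabs_def2 in Hlim; lra.
Qed.

Lemma eta_per (x : R) : eta (x + lam) = eta x.
Proof. apply (sw_eta_per _ _ _ _ _ _ _ _ Hwave). Qed.

(** The two sides have the same derivative in [y] by periodicity of [u], and both
    tend to zero at the surface. *)
Lemma psi_per (x y : R) : fluid eta x y -> psi (x + lam) y = psi x y.
Proof.
  unfold fluid; intros Hxy.
  set (K := fun z => psi (x + lam) z - psi x z).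
  assert (HK : forall z, z < eta x -> K z = K y).
  { intros z Hz; apply is_derive_0_const; intros w Hw.
    assert (Hw' : w < eta x)
      by (unfold Rmin, Rmax in Hw; destruct Rle_dec in Hw; lra).
    replace 0 with ((u (x + lam) w - c) - (u x w - c)).
    - apply (is_derive_minus (fun z => psi (x + lam) z) (fun z => psi x z));
        apply (sf_y _ _ _ _ _ Hpsi); unfold fluid; rewrite ?eta_per; trivial.
    - rewrite (sw_u_per _ _ _ _ _ _ _ _ Hwave) by (unfold closed_fluid; lra). ring. }
  enough (K y = 0) by (unfold K in *; lra).
  destruct (Req_dec (K y) 0) as [?|Hne]; trivial; exfalso.
  assert (Hpos : 0 < Rabs (K y) / 2) by (generalize (Rabs_pos_lt _ Hne); lra).
  destruct (surface_limit psi x _ (sf_cont _ _ _ _ _ Hpsi) Hpos) as (d1 & Hd1 & L1).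
  destruct (surface_limit psi (x + lam) _ (sf_cont _ _ _ _ _ Hpsi) Hpos) as (d2 & Hd2 & L2).
  rewrite (sf_surface _ _ _ _ _ Hpsi) in L1, L2.
  rewrite eta_per in L2.
  set (w := eta x - Rmin d1 d2 / 2).
  assert (0 < Rmin d1 d2) by (apply Rmin_pos; lra).
  generalize (Rmin_l d1 d2) (Rmin_r d1 d2); intros.
  specialize (L1 w ltac:(unfold w; lra)); specialize (L2 w ltac:(unfold w; lra)).
  assert (E : K w = K y) by (apply HK; unfold w; lra).
  generalize (Rabs_triang (psi (x + lam) w - 0) (- (psi x w - 0))).
  rewrite Rabs_Ropp, <- E in *.
  replace (psi (x + lam) w - 0 + - (psi x w - 0)) with (K w) by (unfold K; ring).
  lra.
Qed.

Lemma xi_fluid (p x : R) : 0 < p -> fluid eta x (xi p x).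
Proof. intros Hp; apply (Hxi p x Hp). Qed.

Lemma psi_xi (p x : R) : 0 < p -> psi x (xi p x) = p.
Proof. intros Hp; apply (Hxi p x Hp). Qed.

Lemma xi_unique (p x y : R) : 0 < p -> fluid eta x y -> psi x y = p -> y = xi p x.
Proof.
  intros Hp Hy E.
  destruct (Rtotal_order y (xi p x)) as [H|[H|H]]; trivial; exfalso.
  - generalize (psi_decreasing x _ _ Hy (xi_fluid p x Hp) H); rewrite psi_xi; lra.
  - generalize (psi_decreasing x _ _ (xi_fluid p x Hp) Hy H); rewrite psi_xi; lra.
Qed.

Lemma xi_per (p x : R) : 0 < p -> xi p (x + lam) = xi p x.
Proof.
  intros Hp; symmetry; apply xi_unique; trivial.
  - unfold fluid; rewrite eta_per; now apply xi_fluid.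
  - rewrite psi_per by (now apply xi_fluid). now apply psi_xi.
Qed.

Lemma locally_2d_pos_r (x p : R) (Q : R -> R -> Prop) : 0 < p ->
  (forall s r, 0 < r -> Q s r) -> locally_2d Q x p.
Proof.
  intros Hp HQ; exists (mkposreal p Hp); simpl; intros s r _ Hr.
  apply HQ; apply Rabs_def2 in Hr; lra.
Qed.

Lemma xi_continuous (x p : R) : 0 < p -> continuity_2d_pt (fun x p => xi p x) x p.
Proof.
  intros Hp; apply (decreasing_inverse_continuity psi (fluid eta)).
  - intros y Hy; now apply below_surface_locally.
  - apply (locally_2d_1d_const_x (fluid eta)), fluid_open, xi_fluid, Hp.
  - intros y Hy; apply continuity_2d_pt_slice_l, psi_continuous, Hy.
  - intros; now apply psi_decreasing.
  - apply locally_2d_pos_r; trivial; intros; now apply Hxi.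
Qed.

Lemma xi_derive (p x : R) : 0 < p ->
  is_derive (xi p) x (v x (xi p x) / (u x (xi p x) - c)).
Proof.
  intros Hp.
  generalize (xi_fluid p x Hp); intros Hfl.
  generalize (velocity_leftward _ _ Hfl); intros Hneg.
  destruct (curve_derivative (fun x _ => x) psi (fun x => x) (xi p) x
    1 0 (- v x (xi p x)) (u x (xi p x) - c) 1 0) as [_ H].
  - apply differentiable_pt_lim_proj1_0 with (f := fun x => x).
    apply derivable_pt_lim_id.
  - now apply psi_differentiable.
  - lra.
  - apply continuous_id.
  - apply (continuity_2d_pt_slice_l (fun x p => xi p x)); now apply xi_continuous.
  - apply (is_derive_id x).
  - apply (is_derive_ext (fun _ => p)); [intros; symmetry; now apply psi_xi|].
    apply @is_derive_const.
  - replace (_ / _) with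
      ((1 * 0 - - v x (xi p x) * 1) / (1 * (u x (xi p x) - c) - 0 * - v x (xi p x)));
      trivial.
    field; lra.
Qed.

(** [eta] is continuous and periodic, hence bounded below; the potential is
    anchored at such a depth [b]. *)
Lemma exists_floor : exists b, forall x, fluid eta x b.
Proof.
  destruct (continuous_periodic_bounded eta lam lam_pos eta_continuous eta_per) as (m & M & H).
  exists (m - 1); intros x; generalize (H x); unfold fluid; lra.
Qed.

Lemma segment_fluid (x y1 y2 z : R) : fluid eta x y1 -> fluid eta x y2 ->
  Rmin y1 y2 <= z <= Rmax y1 y2 -> fluid eta x z.
Proof.
  unfold fluid, Rmin, Rmax; intros H1 H2 Hz; destruct Rle_dec; lra.
Qed.

(** * Velocity potential *)

Section Potential.

Variable b : R.
Hypothesis Hb : forall x, fluid eta x b.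

(** The line integral of [(u - c) dx + v dy] along the horizontal at depth [b] and
    then along a vertical; both legs stay inside the fluid. *)
Definition potential (x y : R) : R :=
  RInt (fun s => u s b - c) 0 x + RInt (fun s => v x s) b y.

Lemma ex_RInt_v (x y : R) : fluid eta x y -> ex_RInt (fun s => v x s) b y.
Proof.
  intros Hxy; apply @ex_RInt_continuous; intros z Hz.
  apply continuity_2d_pt_slice_r, fluid_continuous; trivial.
  now apply (segment_fluid x b y).
Qed.

Lemma u_floor_continuous (x : R) : continuous (fun s => u s b - c) x.
Proof.
  apply continuous_Rminus; [|apply continuous_const].
  apply (continuity_2d_pt_slice_l u), fluid_continuous; trivial; apply Hb.
Qed.

Lemma potential_y (x y : R) : fluid eta x y ->
  is_derive (fun s => potential x s) y (v x y).
Proof.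
  intros Hxy; unfold potential.
  replace (v x y) with (0 + v x y) by ring.
  apply (is_derive_plus (fun _ => RInt (fun s => u s b - c) 0 x)
    (fun y => RInt (fun s => v x s) b y)).
  - apply @is_derive_const.
  - apply (is_derive_RInt (fun s => v x s) _ b).
    + generalize (locally_2d_1d_const_x _ _ _ (fluid_open x y Hxy)).
      apply filter_imp; intros z Hz; apply @RInt_correct; now apply ex_RInt_v.
    + apply continuity_2d_pt_slice_r, fluid_continuous; trivial.
Qed.

(** Irrotationality turns the [x]-derivative of the vertical leg into the integral
    of [u_y], which is [u x y - u x b]. *)
Lemma potential_x (x y : R) : fluid eta x y ->
  is_derive (fun s => potential s y) x (u x y - c).
Proof.
  intros Hxy; unfold potential.
  replace (u x y - c) with ((u x b - c) + (u x y - u x b)) by ring.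
  apply (is_derive_plus (fun x => RInt (fun s => u s b - c) 0 x)
    (fun x => RInt (fun s => v x s) b y)).
  - apply (is_derive_RInt (fun s => u s b - c) _ 0).
    + apply filter_forall; intros z; apply @RInt_correct, @ex_RInt_continuous.
      intros; apply u_floor_continuous.
    + apply u_floor_continuous.
  - replace (u x y - u x b) with (RInt (fun s => Derive (fun z => v z s) x) b y).
    + apply (is_derive_RInt_param v).
      * assert (HM : Rmax b y < eta x)
          by (apply Rmax_lub_lt; [apply Hb|apply Hxy]).
        generalize (below_surface_locally _ _ HM); apply filter_imp.
        intros s Hs t Ht; apply (vC1 s t); unfold fluid; lra.
      * intros t Ht; apply (vC1 x t); apply (segment_fluid x b y); trivial; apply Hb.
      * generalize (locally_2d_1d_const_y _ _ _ (fluid_open x y Hxy)).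
        apply filter_imp; intros z Hz; now apply ex_RInt_v.
    + apply is_RInt_unique.
      apply (is_RInt_ext (dy u x)).
      * intros z Hz.
        assert (Hf : fluid eta x z)
          by (apply (segment_fluid x b y); trivial; lra).
        generalize (sw_irrotational _ _ _ _ _ _ _ _ Hwave x z Hf).
        unfold dx; lra.
      * apply (is_RInt_derive (fun z => u x z) (dy u x)); intros z Hz;
          assert (Hf : fluid eta x z)
          by (apply (segment_fluid x b y); trivial; apply Hb).
        -- apply Derive_correct, (uC1 x z Hf).
        -- apply continuity_2d_pt_slice_r, (uC1 x z Hf).
Qed.

Lemma potential_differentiable (x y : R) : fluid eta x y ->
  differentiable_pt_lim potential x y (u x y - c) (v x y).
Proof.
  intros Hxy; apply (differentiable_of_partials potential (fun s t => u s t - c)).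
  - generalize (fluid_open x y Hxy); apply locally_2d_impl, locally_2d_forall.
    intros s t Hst; now apply potential_x.
  - apply continuity_2d_pt_minus; [|apply continuity_2d_pt_const].
    now apply fluid_continuous.
  - now apply potential_y.
Qed.

Lemma potential_continuous (x y : R) : fluid eta x y ->
  continuity_2d_pt potential x y.
Proof.
  intros H; apply differentiable_continuity_pt; eexists; eexists.
  now apply potential_differentiable.
Qed.

(** The increment over a wavelength does not depend on the depth, since [v] is
    periodic; by the mean value theorem it equals [lam (u - c)] at some point of
    any given depth, and [u] tends to [0] at infinite depth. *)
Lemma potential_per (x y : R) : fluid eta x y ->
  potential (x + lam) y = potential x y - c * lam.
Proof.
  intros Hxy.
  set (K := RInt (fun s => u s b - c) 0 (x + lam) - RInt (fun s => u s b - c) 0 x).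
  assert (HK : forall z, fluid eta x z -> potential (x + lam) z - potential x z = K).
  { intros z Hz; unfold potential, K.
    replace (RInt (fun s => v (x + lam) s) b z) with (RInt (fun s => v x s) b z).
    - ring.
    - apply RInt_ext; intros s Hs; symmetry.
      apply (sw_v_per _ _ _ _ _ _ _ _ Hwave).
      apply Rlt_le, (segment_fluid x b z); trivial; lra. }
  enough (K = - (c * lam)) by (generalize (HK y Hxy); lra).
  destruct (Req_dec (K + c * lam) 0) as [?|Hne]; [lra|exfalso].
  set (eps := Rabs (K + c * lam) / lam).
  assert (He : 0 < eps) by (apply Rdiv_lt_0_compat; trivial; now apply Rabs_pos_lt).
  destruct (sw_deep _ _ _ _ _ _ _ _ Hwave eps He) as [Y HY].
  set (z := Rmin b (Y - 1)).
  assert (Hz : forall s, fluid eta s z).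
  { intros s; generalize (Hb s); unfold fluid; generalize (Rmin_l b (Y - 1)); fold z; lra. }
  assert (HzY : z < Y) by (generalize (Rmin_r b (Y - 1)); fold z; lra).
  destruct (MVT_gen (fun s => potential s z) x (x + lam) (fun s => u s z - c))
    as (w & _ & Hw).
  - intros s _; now apply potential_x.
  - intros s _; apply continuity_pt_filterlim.
    apply (is_derive_continuous (fun s => potential s z) s (u s z - c)).
    now apply potential_x.
  - simpl in Hw; rewrite (HK z (Hz x)) in Hw.
    destruct (HY w z (Hz w) HzY) as [H _].
    assert (E : Rabs (K + c * lam) = Rabs (u w z) * lam).
    { rewrite Hw.
      replace ((u w z - c) * (x + lam - x) + c * lam) with (u w z * lam) by ring.
      rewrite Rabs_mult, (Rabs_pos_eq lam) by lra. trivial. }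
    assert (Rabs (K + c * lam) = eps * lam) by (unfold eps; field; lra).
    nra.
Qed.

Definition streamline_potential (p x : R) : R := potential x (xi p x).

Lemma speed_pos (x y : R) : fluid eta x y -> 0 < (u x y - c) ^ 2 + v x y ^ 2.
Proof.
  intros H; generalize (velocity_leftward _ _ H) (pow2_ge_0 (v x y)); nra.
Qed.

Lemma streamline_potential_derive (p x : R) : 0 < p ->
  is_derive (streamline_potential p) x
    (((u x (xi p x) - c) ^ 2 + v x (xi p x) ^ 2) / (u x (xi p x) - c)).
Proof.
  intros Hp; generalize (xi_fluid p x Hp); intros Hfl.
  generalize (velocity_leftward _ _ Hfl); intros Hneg.
  apply is_derive_Reals.
  replace (_ / _) with ((u x (xi p x) - c) * 1
     + v x (xi p x) * (v x (xi p x) / (u x (xi p x) - c))) by (field; lra).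
  apply (derivable_pt_lim_comp_2d potential (fun x => x) (xi p)).
  - now apply potential_differentiable.
  - apply derivable_pt_lim_id.
  - apply is_derive_Reals; now apply xi_derive.
Qed.

Lemma streamline_potential_decreasing (p x1 x2 : R) : 0 < p -> x1 < x2 ->
  streamline_potential p x2 < streamline_potential p x1.
Proof.
  intros Hp H; eapply is_derive_neg_decreasing; trivial.
  - intros z _; now apply streamline_potential_derive.
  - intros z _; simpl. generalize (xi_fluid p z Hp); intros Hfl.
    generalize (velocity_leftward _ _ Hfl) (speed_pos _ _ Hfl); intros Hn Hs.
    unfold Rdiv; generalize (Rinv_lt_0_compat _ Hn); nra.
Qed.

Lemma streamline_potential_per (p x : R) : 0 < p ->
  streamline_potential p (x + lam) = streamline_potential p x - c * lam.
Proof.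
  intros Hp; unfold streamline_potential; rewrite xi_per by trivial.
  apply potential_per; now apply xi_fluid.
Qed.

(** By periodicity the potential takes values on both sides of [q] on every
    streamline. *)
Lemma streamline_potential_surjective (p q : R) : 0 < p ->
  exists x, streamline_potential p x = q.
Proof.
  intros Hp.
  assert (Hk : forall k x, streamline_potential p (x + IZR k * lam)
                           = streamline_potential p x - IZR k * (c * lam)).
  { intros k x.
    assert (E := periodic_IZR (fun x => streamline_potential p x + c * x) lam k).
    simpl in E. enough (streamline_potential p (x + IZR k * lam) + c * (x + IZR k * lam)
       = streamline_potential p x + c * x) by lra.
    apply E; intros z; rewrite streamline_potential_per by trivial; ring. }
  assert (Hcl : 0 < c * lam) by (apply Rmult_lt_0_compat; trivial).
  set (r := (streamline_potential p 0 - q) / (c * lam)).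
  assert (Er : streamline_potential p 0 - q = r * (c * lam)) by (unfold r; field; lra).
  destruct (archimed r) as [A1 A2].
  assert (U1 := Hk (up r) 0). assert (U2 := Hk (up r - 1)%Z 0).
  rewrite minus_IZR in U2.
  destruct (IVT_gen (streamline_potential p) (0 + IZR (up r) * lam)
     (0 + (IZR (up r) - 1) * lam) q) as (x & _ & Hx).
  - intros x; apply continuity_pt_filterlim.
    eapply is_derive_continuous; now apply streamline_potential_derive.
  - rewrite U1, U2; split.
    + apply Rle_trans with (streamline_potential p 0 - IZR (up r) * (c * lam)).
      apply Rmin_l. nra.
    + apply Rle_trans with (streamline_potential p 0 - (IZR (up r) - 1) * (c * lam)).
      nra. apply Rmax_r.
  - now exists x.
Qed.

(** * Hodograph coordinates *)

Section Hodograph.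

(** [(X q p, hodograph_y q p)] is the point of the streamline [p] at which the
    potential equals [q], that is, the inverse of [(phi, psi)]. *)
Variable X : R -> R -> R.
Hypothesis HX : forall q p, 0 < p -> streamline_potential p (X q p) = q.

Definition hodograph_y (q p : R) : R := xi p (X q p).

Lemma hodograph_fluid (q p : R) : 0 < p -> fluid eta (X q p) (hodograph_y q p).
Proof. intros Hp; now apply xi_fluid. Qed.

Lemma hodograph_x_unique (q p x : R) : 0 < p -> streamline_potential p x = q -> x = X q p.
Proof.
  intros Hp E.
  destruct (Rtotal_order x (X q p)) as [H|[H|H]]; trivial; exfalso.
  - generalize (streamline_potential_decreasing p _ _ Hp H); rewrite HX; lra.
  - generalize (streamline_potential_decreasing p _ _ Hp H); rewrite HX; lra.
Qed.

Lemma hodograph_x_continuous (q p : R) : 0 < p -> continuity_2d_pt X q p.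
Proof.
  intros Hp.
  apply (continuity_2d_pt_comp (fun p q => X q p) (fun _ p => p) (fun q _ => q)).
  - apply continuity_2d_pt_id2.
  - apply continuity_2d_pt_id1.
  - apply (decreasing_inverse_continuity streamline_potential (fun p _ => 0 < p)).
    + intros _ _. exists (mkposreal p Hp); intros s Hs.
      change (Rabs (s - p) < p) in Hs; apply Rabs_def2 in Hs; lra.
    + apply filter_forall; trivial.
    + intros x _; apply (continuous_comp_2d potential (fun _ => x) (fun p => xi p x)).
      * apply potential_continuous; now apply xi_fluid.
      * apply continuous_const.
      * apply (continuity_2d_pt_slice_r (fun x p => xi p x)); now apply xi_continuous.
    + intros; now apply streamline_potential_decreasing.
    + exists (mkposreal p Hp); simpl; intros r s Hr _; apply Rabs_def2 in Hr.
      split; [lra|]; apply HX; lra.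
Qed.

Lemma hodograph_y_continuous (q p : R) : 0 < p -> continuity_2d_pt hodograph_y q p.
Proof.
  intros Hp; apply (continuity_2d_pt_comp (fun x p => xi p x) X (fun _ p => p)).
  - now apply hodograph_x_continuous.
  - apply continuity_2d_pt_id2.
  - now apply xi_continuous.
Qed.

Definition hodograph_speed2 (q p : R) : R :=
  (u (X q p) (hodograph_y q p) - c) ^ 2 + v (X q p) (hodograph_y q p) ^ 2.

Lemma hodograph_speed2_pos (q p : R) : 0 < p -> 0 < hodograph_speed2 q p.
Proof. intros Hp; apply speed_pos, hodograph_fluid, Hp. Qed.

(** The first column of the inverse of the Jacobian matrix of [(phi, psi)], whose
    determinant is the squared speed; [hodograph_derive_p] is the second column.
    In complex form, [dz/dq = 1 / f] and [dz/dp = i / f]. *)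
Lemma hodograph_derive_q (q p : R) : 0 < p ->
  is_derive (fun q => X q p) q ((u (X q p) (hodograph_y q p) - c) / hodograph_speed2 q p) /\
  is_derive (fun q => hodograph_y q p) q (v (X q p) (hodograph_y q p) / hodograph_speed2 q p).
Proof.
  intros Hp; generalize (hodograph_fluid q p Hp) (hodograph_speed2_pos q p Hp); intros Hf Hs.
  destruct (curve_derivative potential psi (fun q => X q p) (fun q => hodograph_y q p) q
    (u (X q p) (hodograph_y q p) - c) (v (X q p) (hodograph_y q p))
    (- v (X q p) (hodograph_y q p)) (u (X q p) (hodograph_y q p) - c) 1 0) as [H1 H2].
  - now apply potential_differentiable.
  - now apply psi_differentiable.
  - unfold hodograph_speed2 in Hs; lra.
  - now apply (continuity_2d_pt_slice_l X), hodograph_x_continuous.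
  - now apply (continuity_2d_pt_slice_l hodograph_y), hodograph_y_continuous.
  - apply (is_derive_ext (fun q => q)); [|apply (is_derive_id q)].
    intros t; symmetry; now apply HX.
  - apply (is_derive_ext (fun _ => p)); [|apply @is_derive_const].
    intros t; symmetry; now apply psi_xi.
  - unfold hodograph_speed2 in *; split.
    + evar_last; [exact H1|field; lra].
    + evar_last; [exact H2|field; lra].
Qed.

Lemma hodograph_derive_p (q p : R) : 0 < p ->
  is_derive (fun p => X q p) p (- v (X q p) (hodograph_y q p) / hodograph_speed2 q p) /\
  is_derive (fun p => hodograph_y q p) p ((u (X q p) (hodograph_y q p) - c) / hodograph_speed2 q p).
Proof.
  intros Hp; generalize (hodograph_fluid q p Hp) (hodograph_speed2_pos q p Hp); intros Hf Hs.
  assert (Hpos : locally p (fun r => 0 < r)).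
  { exists (mkposreal p Hp); intros s H.
    change (Rabs (s - p) < p) in H; apply Rabs_def2 in H; lra. }
  destruct (curve_derivative potential psi (fun p => X q p) (fun p => hodograph_y q p) p
    (u (X q p) (hodograph_y q p) - c) (v (X q p) (hodograph_y q p))
    (- v (X q p) (hodograph_y q p)) (u (X q p) (hodograph_y q p) - c) 0 1) as [H1 H2].
  - now apply potential_differentiable.
  - now apply psi_differentiable.
  - unfold hodograph_speed2 in Hs; lra.
  - now apply (continuity_2d_pt_slice_r X), hodograph_x_continuous.
  - now apply (continuity_2d_pt_slice_r hodograph_y), hodograph_y_continuous.
  - apply (is_derive_ext_loc (fun _ => q)); [|apply @is_derive_const].
    generalize Hpos; apply filter_imp; intros r Hr; symmetry; now apply HX.
  - apply (is_derive_ext_loc (fun p => p)); [|apply (is_derive_id p)].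
    generalize Hpos; apply filter_imp; intros r Hr; symmetry; now apply psi_xi.
  - unfold hodograph_speed2 in *; split.
    + evar_last; [exact H1|field; lra].
    + evar_last; [exact H2|field; lra].
Qed.

Definition hodograph_u (q p : R) : R := u (X q p) (hodograph_y q p).
Definition hodograph_v (q p : R) : R := v (X q p) (hodograph_y q p).

Definition hodograph_u_q (q p : R) : R :=
  (dx u (X q p) (hodograph_y q p) * (hodograph_u q p - c)
   + dy u (X q p) (hodograph_y q p) * hodograph_v q p) / hodograph_speed2 q p.
Definition hodograph_v_q (q p : R) : R :=
  (dx v (X q p) (hodograph_y q p) * (hodograph_u q p - c)
   + dy v (X q p) (hodograph_y q p) * hodograph_v q p) / hodograph_speed2 q p.

(** The velocity stays conjugate-holomorphic in the new variables, because the
    inverse of the holomorphic map [phi + i psi] is holomorphic. *)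
Lemma hodograph_velocity_cauchy_riemann (q p : R) : 0 < p ->
  is_derive (fun q => hodograph_u q p) q (hodograph_u_q q p) /\
  is_derive (fun q => hodograph_v q p) q (hodograph_v_q q p) /\
  is_derive (fun p => hodograph_u q p) p (hodograph_v_q q p) /\
  is_derive (fun p => hodograph_v q p) p (- hodograph_u_q q p).
Proof.
  intros Hp; generalize (hodograph_fluid q p Hp) (hodograph_speed2_pos q p Hp); intros Hf Hs.
  destruct (hodograph_derive_q q p Hp) as [Xq Yq]. destruct (hodograph_derive_p q p Hp) as [Xp Yp].
  generalize (fluid_differentiable u _ _ uC1 Hf) (fluid_differentiable v _ _ vC1 Hf).
  intros Du Dv.
  generalize (sw_incompressible _ _ _ _ _ _ _ _ Hwave _ _ Hf)
    (sw_irrotational _ _ _ _ _ _ _ _ Hwave _ _ Hf); intros I1 I2.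
  rewrite is_derive_Reals in Xq, Yq, Xp, Yp.
  unfold hodograph_u, hodograph_v; split; [|split; [|split]]; apply is_derive_Reals.
  - evar_last;
      [exact (derivable_pt_lim_comp_2d _ (fun q => X q p) _ _ _ _ _ _ Du Xq Yq)|].
    unfold hodograph_u_q, hodograph_u, hodograph_v; field; lra.
  - evar_last;
      [exact (derivable_pt_lim_comp_2d _ (fun q => X q p) _ _ _ _ _ _ Dv Xq Yq)|].
    unfold hodograph_v_q, hodograph_u, hodograph_v; field; lra.
  - evar_last;
      [exact (derivable_pt_lim_comp_2d _ (fun p => X q p) _ _ _ _ _ _ Du Xp Yp)|].
    unfold hodograph_v_q, hodograph_u, hodograph_v.
    replace (dy u (X q p) (hodograph_y q p)) with (dx v (X q p) (hodograph_y q p)) by lra.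
    replace (dx u (X q p) (hodograph_y q p)) with (- dy v (X q p) (hodograph_y q p)) by lra.
    field; lra.
  - evar_last;
      [exact (derivable_pt_lim_comp_2d _ (fun p => X q p) _ _ _ _ _ _ Dv Xp Yp)|].
    unfold hodograph_u_q, hodograph_u, hodograph_v.
    replace (dy u (X q p) (hodograph_y q p)) with (dx v (X q p) (hodograph_y q p)) by lra.
    replace (dx u (X q p) (hodograph_y q p)) with (- dy v (X q p) (hodograph_y q p)) by lra.
    field; lra.
Qed.

Lemma hodograph_comp_continuous (f : R -> R -> R) (q p : R) : 0 < p ->
  continuity_2d_pt f (X q p) (hodograph_y q p) ->
  continuity_2d_pt (fun q p => f (X q p) (hodograph_y q p)) q p.
Proof.
  intros Hp Hf; apply continuity_2d_pt_comp; trivial;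
    [now apply hodograph_x_continuous|now apply hodograph_y_continuous].
Qed.

Lemma hodograph_u_continuous (q p : R) : 0 < p -> continuity_2d_pt hodograph_u q p.
Proof.
  intros Hp; apply (hodograph_comp_continuous u), fluid_continuous, hodograph_fluid; trivial.
Qed.

Lemma hodograph_v_continuous (q p : R) : 0 < p -> continuity_2d_pt hodograph_v q p.
Proof.
  intros Hp; apply (hodograph_comp_continuous v), fluid_continuous, hodograph_fluid; trivial.
Qed.

Lemma hodograph_u_minus_c_continuous (q p : R) : 0 < p ->
  continuity_2d_pt (fun q p => hodograph_u q p - c) q p.
Proof.
  intros Hp; apply continuity_2d_pt_minus; [now apply hodograph_u_continuous|].
  apply continuity_2d_pt_const.
Qed.

Lemma hodograph_speed2_continuous (q p : R) : 0 < p -> continuity_2d_pt hodograph_speed2 q p.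
Proof.
  intros Hp.
  apply (continuity_2d_pt_ext
    (fun q p => (hodograph_u q p - c) * (hodograph_u q p - c) + hodograph_v q p * hodograph_v q p)).
  - intros; unfold hodograph_speed2, hodograph_u, hodograph_v; ring.
  - apply continuity_2d_pt_plus; apply continuity_2d_pt_mult;
      try (now apply hodograph_u_minus_c_continuous); now apply hodograph_v_continuous.
Qed.

Lemma div_hodograph_speed2_continuous (f : R -> R -> R) (q p : R) : 0 < p ->
  continuity_2d_pt f q p -> continuity_2d_pt (fun q p => f q p / hodograph_speed2 q p) q p.
Proof.
  intros Hp Hf; apply continuity_2d_pt_mult; trivial.
  apply continuity_2d_pt_inv; [now apply hodograph_speed2_continuous|].
  apply Rgt_not_eq; now apply hodograph_speed2_pos.
Qed.

Lemma hodograph_u_q_continuous (q p : R) : 0 < p -> continuity_2d_pt hodograph_u_q q p.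
Proof.
  intros Hp; apply div_hodograph_speed2_continuous; trivial.
  apply continuity_2d_pt_plus; apply continuity_2d_pt_mult.
  - apply (hodograph_comp_continuous (dx u)); trivial; apply uC1; now apply hodograph_fluid.
  - now apply hodograph_u_minus_c_continuous.
  - apply (hodograph_comp_continuous (dy u)); trivial; apply uC1; now apply hodograph_fluid.
  - now apply hodograph_v_continuous.
Qed.

Lemma hodograph_v_q_continuous (q p : R) : 0 < p -> continuity_2d_pt hodograph_v_q q p.
Proof.
  intros Hp; apply div_hodograph_speed2_continuous; trivial.
  apply continuity_2d_pt_plus; apply continuity_2d_pt_mult.
  - apply (hodograph_comp_continuous (dx v)); trivial; apply vC1; now apply hodograph_fluid.
  - now apply hodograph_u_minus_c_continuous.
  - apply (hodograph_comp_continuous (dy v)); trivial; apply vC1; now apply hodograph_fluid.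
  - now apply hodograph_v_continuous.
Qed.

(** [defect_re + i defect_im] is [F = 1 + c / f] with [f = u - c - i v]; it vanishes
    exactly where the fluid is at rest in the fixed frame. *)
Definition defect_re (q p : R) : R :=
  1 + c * ((hodograph_u q p - c) / hodograph_speed2 q p).
Definition defect_im (q p : R) : R := c * (hodograph_v q p / hodograph_speed2 q p).

(** [defect_re_q + i defect_im_q = - c f_q / f^2], with [1 / f^2] written as
    [conj (f)^2 / |f|^4]. *)
Definition defect_re_q (q p : R) : R :=
  c * ((hodograph_u_q q p * (hodograph_v q p ^ 2 - (hodograph_u q p - c) ^ 2)
        - 2 * (hodograph_u q p - c) * hodograph_v q p * hodograph_v_q q p)
       / hodograph_speed2 q p / hodograph_speed2 q p).
Definition defect_im_q (q p : R) : R :=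
  c * ((hodograph_v_q q p * ((hodograph_u q p - c) ^ 2 - hodograph_v q p ^ 2)
        - 2 * (hodograph_u q p - c) * hodograph_v q p * hodograph_u_q q p)
       / hodograph_speed2 q p / hodograph_speed2 q p).

Lemma is_derive_defect (f w : R -> R) (t f' w' : R) :
  is_derive f t f' -> is_derive w t w' -> 0 < (f t - c) ^ 2 + w t ^ 2 ->
  is_derive (fun t => 1 + c * ((f t - c) / ((f t - c) ^ 2 + w t ^ 2))) t
    (c * ((f' * (w t ^ 2 - (f t - c) ^ 2) - 2 * (f t - c) * w t * w')
       / ((f t - c) ^ 2 + w t ^ 2) / ((f t - c) ^ 2 + w t ^ 2))) /\
  is_derive (fun t => c * (w t / ((f t - c) ^ 2 + w t ^ 2))) t
    (c * ((w' * ((f t - c) ^ 2 - w t ^ 2) - 2 * (f t - c) * w t * f')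
       / ((f t - c) ^ 2 + w t ^ 2) / ((f t - c) ^ 2 + w t ^ 2))).
Proof.
  intros Hf Hw Hn.
  assert (Ef : ex_derive f t) by (now exists f').
  assert (Ew : ex_derive w t) by (now exists w').
  split; auto_derive.
  - simpl in Hn; intuition lra.
  - change (Derive (fun s => f s) t) with (Derive f t);
    change (Derive (fun s => w s) t) with (Derive w t).
    rewrite (is_derive_unique f t f' Hf), (is_derive_unique w t w' Hw).
    field; simpl in *; lra.
  - simpl in Hn; intuition lra.
  - change (Derive (fun s => f s) t) with (Derive f t);
    change (Derive (fun s => w s) t) with (Derive w t).
    rewrite (is_derive_unique f t f' Hf), (is_derive_unique w t w' Hw).
    field; simpl in *; lra.
Qed.

Lemma defect_cauchy_riemann (q p : R) : 0 < p ->
  is_derive (fun q => defect_re q p) q (defect_re_q q p) /\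
  is_derive (fun q => defect_im q p) q (defect_im_q q p) /\
  is_derive (fun p => defect_re q p) p (- defect_im_q q p) /\
  is_derive (fun p => defect_im q p) p (defect_re_q q p).
Proof.
  intros Hp.
  destruct (hodograph_velocity_cauchy_riemann q p Hp) as (Uq & Vq & Up & Vp).
  assert (Hs := hodograph_speed2_pos q p Hp).
  destruct (is_derive_defect _ _ _ _ _ Uq Vq Hs) as [H1 H2].
  destruct (is_derive_defect _ _ _ _ _ Up Vp Hs) as [H3 H4].
  split; [trivial|split; [trivial|split]].
  - evar_last; [exact H3|]. unfold defect_im_q, hodograph_speed2, hodograph_u, hodograph_v in *; field; lra.
  - evar_last; [exact H4|]. unfold defect_re_q, hodograph_speed2, hodograph_u, hodograph_v in *; field; lra.
Qed.

Lemma scal_c_continuous (f : R -> R -> R) (q p : R) :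
  continuity_2d_pt f q p -> continuity_2d_pt (fun q p => c * f q p) q p.
Proof.
  intros Hf; apply continuity_2d_pt_mult; trivial; apply continuity_2d_pt_const.
Qed.

Lemma defect_re_continuous (q p : R) : 0 < p -> continuity_2d_pt defect_re q p.
Proof.
  intros Hp; apply continuity_2d_pt_plus; [apply continuity_2d_pt_const|].
  apply scal_c_continuous, div_hodograph_speed2_continuous; trivial.
  now apply hodograph_u_minus_c_continuous.
Qed.

Lemma defect_im_continuous (q p : R) : 0 < p -> continuity_2d_pt defect_im q p.
Proof.
  intros Hp; apply scal_c_continuous, div_hodograph_speed2_continuous; trivial.
  now apply hodograph_v_continuous.
Qed.

Lemma defect_q_continuous (q p : R) : 0 < p ->
  continuity_2d_pt defect_re_q q p /\ continuity_2d_pt defect_im_q q p.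
Proof.
  intros Hp.
  assert (H1 := hodograph_u_minus_c_continuous q p Hp). assert (H2 := hodograph_v_continuous q p Hp).
  assert (H3 := hodograph_u_q_continuous q p Hp). assert (H4 := hodograph_v_q_continuous q p Hp).
  split; apply scal_c_continuous; repeat (apply div_hodograph_speed2_continuous; trivial);
    simpl; repeat first [assumption | apply continuity_2d_pt_const
      | apply continuity_2d_pt_minus | apply continuity_2d_pt_mult].
Qed.

Lemma hodograph_x_per (q p : R) : 0 < p -> X (q + c * lam) p = X q p - lam.
Proof.
  intros Hp; symmetry; apply hodograph_x_unique; trivial.
  assert (H := streamline_potential_per p (X q p - lam) Hp).
  replace (X q p - lam + lam) with (X q p) in H by ring.
  rewrite HX in H by trivial; lra.
Qed.

Lemma xi_per_sub (p x : R) : 0 < p -> xi p (x - lam) = xi p x.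
Proof.
  intros Hp; rewrite <- (xi_per p (x - lam) Hp); f_equal; ring.
Qed.

Lemma hodograph_velocity_per (q p : R) : 0 < p ->
  hodograph_u (q + c * lam) p = hodograph_u q p /\ hodograph_v (q + c * lam) p = hodograph_v q p.
Proof.
  intros Hp; unfold hodograph_u, hodograph_v, hodograph_y; rewrite hodograph_x_per, xi_per_sub by trivial.
  set (x := X q p).
  assert (Hcl : closed_fluid eta (x - lam) (xi p x)).
  { rewrite <- xi_per_sub by trivial; apply Rlt_le, xi_fluid; trivial. }
  rewrite <- (sw_u_per _ _ _ _ _ _ _ _ Hwave _ _ Hcl),
    <- (sw_v_per _ _ _ _ _ _ _ _ Hwave _ _ Hcl).
  replace (x - lam + lam) with x by ring. split; trivial.
Qed.

Lemma defect_per (q p : R) : 0 < p ->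
  defect_re (q + c * lam) p = defect_re q p /\ defect_im (q + c * lam) p = defect_im q p.
Proof.
  intros Hp; unfold defect_re, defect_im, hodograph_speed2; fold (hodograph_u q p) (hodograph_v q p) (hodograph_u (q + c * lam) p)
    (hodograph_v (q + c * lam) p).
  destruct (hodograph_velocity_per q p Hp) as [-> ->]; split; trivial.
Qed.

(** * The energy as a function of the streamline *)

Definition energy_density (q p : R) : R :=
  defect_re q p * defect_re q p + defect_im q p * defect_im q p.

(** [|F|^2 = |f + c|^2 / |f|^2], and [f + c = u - i v]. *)
Lemma energy_density_eq (q p : R) : 0 < p ->
  energy_density q p = (hodograph_u q p ^ 2 + hodograph_v q p ^ 2) / hodograph_speed2 q p.
Proof.
  intros Hp; assert (Hs := hodograph_speed2_pos q p Hp).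
  unfold energy_density, defect_re, defect_im, hodograph_speed2, hodograph_u, hodograph_v in *; field; lra.
Qed.

Definition energy (p : R) : R := / 2 * line_pairing defect_re defect_im (c * lam) p p.

Lemma period_pos : 0 < c * lam.
Proof. now apply Rmult_lt_0_compat. Qed.

Lemma energy_nonneg (p : R) : 0 < p -> 0 <= energy p.
Proof.
  intros Hp; apply Rmult_le_pos; [lra|].
  apply line_pairing_nonneg; trivial; try apply period_pos; intros;
    [now apply defect_re_continuous|now apply defect_im_continuous].
Qed.

Lemma energy_continuous (p : R) : 0 < p -> continuous energy p.
Proof.
  intros Hp; apply continuous_Rmult; [apply continuous_const|].
  apply (line_mean_continuous defect_re defect_im defect_re_q defect_im_q); trivial; intros;
    try (now apply defect_cauchy_riemann); try (now apply defect_q_continuous);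
    [now apply defect_re_continuous|now apply defect_im_continuous].
Qed.

Lemma energy_log_midpoint (a a' : R) : 0 < a -> 0 < a' ->
  energy ((a + a') / 2) ^ 2 <= energy a * energy a'.
Proof.
  intros Ha Ha'.
  assert (H : line_pairing defect_re defect_im (c * lam) ((a + a') / 2) ((a + a') / 2) ^ 2
    <= line_pairing defect_re defect_im (c * lam) a a * line_pairing defect_re defect_im (c * lam) a' a').
  { apply (line_mean_log_midpoint defect_re defect_im defect_re_q defect_im_q); trivial; try apply period_pos; intros;
    try (now apply defect_cauchy_riemann); try (now apply defect_q_continuous);
    try (now apply defect_per);
    [now apply defect_re_continuous|now apply defect_im_continuous]. }
  unfold energy; lra.
Qed.

Lemma energy_density_continuous (q p : R) : 0 < p -> continuous (fun q => energy_density q p) q.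
Proof.
  intros Hp; apply line_pairing_integrand_continuous; trivial; intros;
    [now apply defect_re_continuous|now apply defect_im_continuous].
Qed.

Lemma energy_density_per (q p : R) : 0 < p -> energy_density (q + c * lam) p = energy_density q p.
Proof.
  intros Hp; unfold energy_density; destruct (defect_per q p Hp) as [-> ->]; trivial.
Qed.

(** At large [p] the whole streamline lies so deep that [|u|, |v| < c / 2], and
    there [(u^2 + v^2) / ((u - c)^2 + v^2) <= 2]. *)
Lemma energy_bounded : exists p0 K, forall p, p0 < p -> energy p <= K.
Proof.
  destruct (sw_deep _ _ _ _ _ _ _ _ Hwave (c / 2) ltac:(lra)) as [Y0 HY].
  set (z := Rmin b (Y0 - 1)).
  assert (Hz : forall s, fluid eta s z).
  { intros s; generalize (Hb s); unfold fluid; generalize (Rmin_l b (Y0 - 1)); fold z; lra. }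
  assert (HzY : z < Y0) by (generalize (Rmin_r b (Y0 - 1)); fold z; lra).
  destruct (continuous_periodic_bounded (fun x => psi x z) lam lam_pos) as (m & M & HM).
  - intros x; apply (continuity_2d_pt_slice_l psi); now apply psi_continuous.
  - intros x; now apply psi_per.
  - exists (Rmax M 0), (/ 2 * ((c * lam - 0) * 2)); intros p HpM.
    assert (Hp : 0 < p) by (generalize (Rmax_r M 0); lra).
    assert (HM' : M < p) by (generalize (Rmax_l M 0); lra).
    apply Rmult_le_compat_l; [lra|].
    eapply Rle_trans; [apply Rle_abs|].
    apply abs_RInt_le_const; [apply Rlt_le, period_pos| |].
    + apply @ex_RInt_continuous; intros q _; now apply energy_density_continuous.
    + intros q _; fold (energy_density q p).
      assert (Hdeep : hodograph_y q p < Y0).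
      { destruct (Rlt_or_le (hodograph_y q p) z) as [?|[H|H]]; [lra| |].
        - generalize (psi_decreasing (X q p) z (hodograph_y q p) (Hz _) (hodograph_fluid q p Hp) H)
            (HM (X q p)).
          unfold hodograph_y; rewrite psi_xi by trivial; lra.
        - rewrite <- H; trivial. }
      destruct (HY _ _ (hodograph_fluid q p Hp) Hdeep) as [H1 H2].
      fold (hodograph_u q p) (hodograph_v q p) in H1, H2.
      apply Rabs_def2 in H1; apply Rabs_def2 in H2.
      assert (Hs := hodograph_speed2_pos q p Hp).
      rewrite Rabs_pos_eq by (unfold energy_density; nra).
      rewrite energy_density_eq by trivial.
      apply (Rmult_le_reg_r (hodograph_speed2 q p)); trivial.
      unfold Rdiv; rewrite Rmult_assoc, Rinv_l, Rmult_1_r by lra.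
      unfold hodograph_speed2; fold (hodograph_u q p) (hodograph_v q p). nra.
Qed.

(** If [v] vanished in the fluid it would vanish on the surface by continuity, and
    the kinematic condition with [u < c] would make [eta] constant. *)
Lemma surface_not_flat : ~ forall x y, fluid eta x y -> v x y = 0.
Proof.
  intros H0.
  assert (Hv : forall x, v x (eta x) = 0).
  { intros x; destruct (Req_dec (v x (eta x)) 0) as [?|Hne]; trivial; exfalso.
    destruct (surface_limit v x (Rabs (v x (eta x)))
      (sw_v_cont _ _ _ _ _ _ _ _ Hwave) (Rabs_pos_lt _ Hne)) as (d & Hd & L).
    specialize (L (eta x - d / 2) ltac:(lra)).
    rewrite H0, Rminus_0_l, Rabs_Ropp in L by (unfold fluid; lra). lra. }
  assert (He : eta 0 = eta (lam / 2)).
  { apply is_derive_0_const; intros x _.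
    replace 0 with (Derive eta x).
    - apply Derive_correct, (sw_eta_diff _ _ _ _ _ _ _ _ Hwave).
    - generalize (sw_kinematic _ _ _ _ _ _ _ _ Hwave x)
        (sw_no_stagnation _ _ _ _ _ _ _ _ Hwave x (eta x) ltac:(unfold closed_fluid; lra)).
      rewrite Hv; intros E Hn; symmetry in E; apply Rmult_integral in E.
      destruct E; [lra|trivial]. }
  generalize (sw_eta_decr _ _ _ _ _ _ _ _ Hwave 0 (lam / 2)); lra.
Qed.

Lemma energy_pos (p : R) : 0 < p -> 0 < energy p.
Proof.
  intros Hp; destruct (Req_dec (energy p) 0) as [E|Hne];
    [exfalso|generalize (energy_nonneg p Hp); lra].
  apply surface_not_flat; intros x y Hxy.
  set (r := psi x y). assert (Hr : 0 < r) by (now apply psi_pos).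
  assert (Er : energy r = 0)
    by (apply (log_midpoint_convex_zero energy p); trivial;
        [apply energy_nonneg|apply energy_log_midpoint]).
  set (q := streamline_potential r x).
  assert (Ex : x = X q r) by (now apply hodograph_x_unique).
  assert (Ey : y = hodograph_y q r) by (unfold hodograph_y; rewrite <- Ex; now apply xi_unique).
  assert (Hd : energy_density q r = 0).
  { apply (RInt_periodic_zero (fun q => energy_density q r) (c * lam)).
    - apply period_pos.
    - intros; now apply energy_density_continuous.
    - intros; now apply energy_density_per.
    - intros z; unfold energy_density; nra.
    - unfold energy, line_pairing in Er; unfold energy_density; lra. }
  assert (HB : defect_im q r = 0) by (unfold energy_density in Hd; nra).
  unfold defect_im in HB; rewrite Ex, Ey; fold (hodograph_v q r).
  assert (Hs := hodograph_speed2_pos q r Hr).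
  replace (hodograph_v q r) with (defect_im q r * hodograph_speed2 q r / c) by (unfold defect_im; field; lra).
  unfold defect_im; rewrite HB; unfold Rdiv; ring.
Qed.

(** * Particle paths *)

(** The path may a priori touch the surface; only the value of [psi] along it
    shows that it does not. *)
Section Path.

Variables (p x0 : R) (x y : R -> R) (T : R).
Hypothesis Hp : 0 < p.
Hypothesis Hpath : particle_path c eta u v x0 (xi p x0) x y.
Hypothesis HT : time_period c lam x0 x T.

Let Xm (t : R) : R := x t - c * t.

Lemma moving_x_derive (t : R) : is_derive Xm t (u (Xm t) (y t) - c).
Proof.
  apply (is_derive_minus x (fun t => c * t)).
  - apply (pp_x _ _ _ _ _ _ _ _ Hpath).
  - auto_derive; trivial; ring.
Qed.

Lemma path_y_derive (t : R) : is_derive y t (v (Xm t) (y t)).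
Proof. apply (pp_y _ _ _ _ _ _ _ _ Hpath). Qed.

Let h (t : R) : R := psi (Xm t) (y t).

(** [psi] is continuous on the closed fluid domain only, so the path has to be seen
    as a map into that domain. *)
Lemma path_psi_continuous (t : R) : continuous h t.
Proof.
  unfold continuous, h.
  apply (filterlim_comp _ _ _ (fun t => (Xm t, y t))
    (fun z : R * R => psi (fst z) (snd z)) (locally t)
    (within (fun z : R * R => closed_fluid eta (fst z) (snd z)) (locally (Xm t, y t)))).
  - assert (Hc : filterlim (fun t => (Xm t, y t)) (locally t) (locally (Xm t, y t))).
    { apply (continuous_comp_2 Xm y (fun a d => (a, d)) t).
      - eapply is_derive_continuous, moving_x_derive.
      - eapply is_derive_continuous, path_y_derive.
      - apply (continuous_ext (fun z => z)); [now intros []|apply continuous_id]. }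
    intros Q HQ; specialize (Hc _ HQ); unfold filtermap in *.
    revert Hc; apply filter_imp; intros s Hs; apply Hs.
    apply (pp_fluid _ _ _ _ _ _ _ _ Hpath).
  - apply (sf_cont _ _ _ _ _ Hpsi (Xm t, y t)).
    apply (pp_fluid _ _ _ _ _ _ _ _ Hpath).
Qed.

Lemma path_psi_nonzero_fluid (t : R) : h t <> 0 -> fluid eta (Xm t) (y t).
Proof.
  intros Hh; destruct (pp_fluid _ _ _ _ _ _ _ _ Hpath t) as [H|H]; trivial.
  elim Hh; unfold h; fold (Xm t) in H; rewrite H; apply (sf_surface _ _ _ _ _ Hpsi).
Qed.

Lemma path_psi_derive (t : R) : h t <> 0 -> is_derive h t 0.
Proof.
  intros Hh; assert (Hf := path_psi_nonzero_fluid t Hh); apply is_derive_Reals.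
  evar_last; [apply (derivable_pt_lim_comp_2d psi Xm y);
    [now apply psi_differentiable
    |apply is_derive_Reals, moving_x_derive|apply is_derive_Reals, path_y_derive]|ring].
Qed.

Lemma path_psi_locally_constant (t : R) : h t <> 0 -> locally t (fun s => h s = h t).
Proof.
  intros Hh.
  destruct (proj2 (continuous_R_eps _ _) (path_psi_continuous t) _ (Rabs_pos_lt _ Hh)) as [d Hd].
  exists d; intros s Hs; change (Rabs (s - t) < d) in Hs.
  apply is_derive_0_const; intros z Hz; apply path_psi_derive; intros E.
  assert (Hz' : Rabs (z - t) < d).
  { eapply Rle_lt_trans; [|exact Hs].
    unfold Rmin, Rmax in Hz; destruct Rle_dec in Hz; unfold Rabs;
      repeat destruct Rcase_abs; lra. }
  specialize (Hd z Hz'); rewrite E, Rminus_0_l, Rabs_Ropp in Hd; lra.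
Qed.

(** [psi] is locally constant along the path wherever it is nonzero, but could
    jump off this value only by passing through zero.  Truncating it below at
    [p / 2] removes the points where differentiability is unknown. *)
Lemma path_psi_constant (t : R) : h t = p.
Proof.
  assert (h0 : h 0 = p).
  { unfold h, Xm; rewrite (pp_x0 _ _ _ _ _ _ _ _ Hpath), (pp_y0 _ _ _ _ _ _ _ _ Hpath).
    rewrite Rmult_0_r, Rminus_0_r; now apply psi_xi. }
  assert (E : Rmax (h t) (p / 2) = Rmax (h 0) (p / 2)).
  { apply (is_derive_0_const (fun t => Rmax (h t) (p / 2))); intros z _.
    destruct (Req_dec (h z) 0) as [E|Hne].
    - apply (is_derive_ext_loc (fun _ => p / 2)); [|apply @is_derive_const].
      generalize (proj2 (continuous_R_eps _ _) (path_psi_continuous z) (p / 2) ltac:(lra)).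
      apply filter_imp; intros s Hs; apply Rabs_def2 in Hs.
      rewrite Rmax_right; lra.
    - apply (is_derive_ext_loc (fun _ => Rmax (h z) (p / 2))); [|apply @is_derive_const].
      generalize (path_psi_locally_constant z Hne); apply filter_imp; intros s ->; trivial. }
  rewrite h0, (Rmax_left p) in E by lra.
  unfold Rmax in E; destruct Rle_dec in E; lra.
Qed.

Lemma path_fluid (t : R) : fluid eta (Xm t) (y t).
Proof. apply path_psi_nonzero_fluid; rewrite path_psi_constant; lra. Qed.

Lemma path_streamline (t : R) : y t = xi p (Xm t).
Proof. apply xi_unique; trivial; [apply path_fluid|apply path_psi_constant]. Qed.

Let q (t : R) : R := potential (Xm t) (y t).

Let path_speed2 (t : R) : R := (u (Xm t) (y t) - c) ^ 2 + v (Xm t) (y t) ^ 2.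

Lemma path_hodograph (t : R) : X (q t) p = Xm t /\ hodograph_y (q t) p = y t.
Proof.
  assert (E : Xm t = X (q t) p).
  { apply hodograph_x_unique; trivial; unfold streamline_potential, q.
    now rewrite <- path_streamline. }
  unfold hodograph_y; rewrite <- E, <- path_streamline; split; trivial.
Qed.

Lemma path_potential_derive (t : R) : is_derive q t (path_speed2 t).
Proof.
  apply is_derive_Reals; evar_last; [apply (derivable_pt_lim_comp_2d potential Xm y);
    [apply potential_differentiable, path_fluid
    |apply is_derive_Reals, moving_x_derive|apply is_derive_Reals, path_y_derive]|].
  unfold path_speed2; ring.
Qed.

Lemma path_speed2_continuous (t : R) : continuous path_speed2 t.
Proof.
  assert (Hc : forall f, C1_in (fluid eta) f -> continuous (fun t => f (Xm t) (y t)) t).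
  { intros f Hf; apply continuous_comp_2d.
    - apply fluid_continuous; trivial; apply path_fluid.
    - eapply is_derive_continuous, moving_x_derive.
    - eapply is_derive_continuous, path_y_derive. }
  assert (E : forall s, (u (Xm s) (y s) - c) * (u (Xm s) (y s) - c)
    + v (Xm s) (y s) * v (Xm s) (y s) = path_speed2 s)
    by (intros s; unfold path_speed2; ring).
  apply (continuous_ext _ _ t E).
  apply continuous_Rplus; apply continuous_Rmult; try apply continuous_Rminus;
      try apply continuous_const; apply Hc; trivial.
Qed.

Lemma path_potential_period : q T = q 0 + c * lam.
Proof.
  assert (E : forall t, q t = streamline_potential p (Xm t))
    by (intros t; unfold q, streamline_potential; now rewrite <- path_streamline).
  rewrite !E. destruct HT as [_ HT']. unfold Xm at 1; rewrite HT'.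
  unfold Xm; rewrite (pp_x0 _ _ _ _ _ _ _ _ Hpath), Rmult_0_r, Rminus_0_r.
  assert (H := streamline_potential_per p (x0 - lam) Hp).
  replace (x0 - lam + lam) with x0 in H by ring. lra.
Qed.

(** The change of variables [dq = ((u - c)^2 + v^2) dt]; the starting value of [q]
    drops out because the integrand is periodic in [q]. *)
Lemma kinetic_energy_eq : kinetic_energy x y T = energy p.
Proof.
  unfold kinetic_energy, energy; f_equal.
  transitivity (RInt (fun t => scal (path_speed2 t) (energy_density (q t) p)) 0 T).
  - apply RInt_ext; intros t _.
    rewrite (is_derive_unique x t _ (pp_x _ _ _ _ _ _ _ _ Hpath t)),
      (is_derive_unique y t _ (path_y_derive t)).
    fold (Xm t).
    rewrite energy_density_eq by trivial.
    assert (Hs := speed_pos _ _ (path_fluid t)).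
    unfold hodograph_speed2, hodograph_u, hodograph_v; destruct (path_hodograph t) as [-> ->].
    unfold scal; simpl; unfold mult; simpl; unfold path_speed2; field; lra.
  - rewrite (RInt_comp (fun q => energy_density q p) q path_speed2).
    + rewrite path_potential_period, RInt_periodic; trivial.
      * intros; now apply energy_density_continuous.
      * intros; now apply energy_density_per.
    + intros; now apply energy_density_continuous.
    + intros; split; [apply path_potential_derive|apply path_speed2_continuous].
Qed.

Lemma moving_kinetic_energy_eq : moving_kinetic_energy c x y T = c * lam / 2.
Proof.
  unfold moving_kinetic_energy.
  rewrite (RInt_ext _ path_speed2).
  - rewrite (is_RInt_unique _ _ _ _ (is_RInt_derive q path_speed2 0 T
      (fun t _ => path_potential_derive t) (fun t _ => path_speed2_continuous t))).
    rewrite path_potential_period; unfold minus, plus, opp; simpl; field.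
  - intros t _.
    now rewrite (is_derive_unique x t _ (pp_x _ _ _ _ _ _ _ _ Hpath t)),
      (is_derive_unique y t _ (path_y_derive t)).
Qed.

End Path.
End Hodograph.
End Potential.
End Wave.

Theorem theorem4p1 (c lam g Patm : R) (eta : R -> R)
    (u v P psi xi : R -> R -> R)
    (x y : R -> R -> R -> R) (T : R -> R -> R)
    (Hwave : stokes_wave c lam g Patm eta u v P)
    (Hpsi : stream_function c eta u v psi)
    (Hxi : streamlines eta psi xi)
    (Hpath : forall p x0, 0 < p ->
       particle_path c eta u v x0 (xi p x0) (x p x0) (y p x0))
    (HT : forall p x0, 0 < p -> time_period c lam x0 (x p x0) (T p x0)) :
  (exists E : R -> R,
      (forall p x0, 0 < p ->
         kinetic_energy (x p x0) (y p x0) (T p x0) = E p)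
      /\ convex_pos E
      /\ nonincreasing_pos E
      /\ (forall p, 0 < p -> 0 < E p)
      /\ convex_pos (fun p => ln (E p)))
  /\ (forall p x0, 0 < p ->
        moving_kinetic_energy c (x p x0) (y p x0) (T p x0) = c * lam / 2).
Proof.
  destruct (exists_floor c lam g Patm eta u v P Hwave) as [b Hb].
  destruct (functional_choice
    (fun (z : R * R) x => 0 < snd z ->
       streamline_potential c u v xi b (snd z) x = fst z)) as [X0 HX0].
  { intros [q p]; simpl; destruct (Rlt_or_le 0 p) as [Hp|Hp].
    - destruct (streamline_potential_surjective c lam g Patm eta u v P psi xi
        Hwave Hpsi Hxi b Hb p q Hp) as [s Hs]; now exists s.
    - exists 0; lra. }
  set (X := fun q p => X0 (q, p)).
  assert (HX : forall q p, 0 < p -> streamline_potential c u v xi b p (X q p) = q)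
    by (intros q p Hp; exact (HX0 (q, p) Hp)).
  set (E := energy c lam u v xi X).
  assert (Hpos : forall p, 0 < p -> 0 < E p) by (intros; eapply energy_pos; eassumption).
  destruct (log_midpoint_convex E) as [Hconv Hlog].
  - intros; eapply energy_continuous; eassumption.
  - intros; now apply Rlt_le, Hpos.
  - intros; eapply energy_log_midpoint; eassumption.
  - destruct (energy_bounded c lam g Patm eta u v P psi xi Hwave Hpsi Hxi b Hb X HX)
      as (p0 & K & HK).
    split; [exists E; repeat split; auto|].
    + intros; eapply kinetic_energy_eq; eauto.
    + now apply (convex_pos_bounded_nonincreasing E p0 K).
    + intros; eapply moving_kinetic_energy_eq; eauto.
Qed.
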